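(* Let $G$ be a countable group acting deeply transitively on a Cantor set $X$. If $\mathcal{M}_G(X)=\emptyset$, then $(\mathcal{K}(X),G)$ is uniquely ergodic with unique invariant measure $\delta_X$. If $\mathcal{M}_G(X)\ne\emptyset$ and $\mu\in\mathcal{M}_G(X)$, then for every invariant random compact $\nu$ of the system there exists a nonnegative sequence $(c_i)_{i\ge0}$ satisfying $\sum_{i=0}^\infty c_i=1$ such that $$\nu=\sum_{i=1}^\infty c_i\,\mu_i^{\mathcal{K}}+c_0\,\delta_X.$$
   Context: Let $X$ be a Cantor set with a compatible metric. For a compact metric space $Z$ with a continuous $G$-action, $\mathcal{M}_G(Z)$ is the set of $G$-invariant Borel probability measures on $Z$. $\mathcal{K}(X)$ is the space of nonempty compact subsets of $X$ with the Hausdorff metric, with the induced action $g\cdot A=g(A)$; an invariant random compact is an element of $\mathcal{M}_G(\mathcal{K}(X))$; $\delta_X$ is the Dirac mass at the point $X\in\mathcal{K}(X)$. For $k\ge1$ let $\rho_k\colon X^k\to\mathcal{K}(X)$, $\rho_k(x_1,\dots,x_k)=\{x_1,\dots,x_k\}$, and for $\mu\in\mathcal{M}_G(X)$ let $\mu_k^{\mathcal{K}}=(\rho_k)_*(\mu^{\otimes k})$, where $\mu^{\otimes k}$ is the $k$-fold product measure. A tree structure for $X$ is a sequence of finite clopen partitions $\mathcal{C}_i=\{C^i_1,\dots,C^i_{\kappa(i)}\}$, $i\ge 1$, of $X$ (into nonempty sets) such that: (a) $\mathcal{C}_{i+1}$ refines $\mathcal{C}_i$ for every $i$; (b) $\max\{\operatorname{diam}(C):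 C\in\mathcal{C}_i\}\to 0$ as $i\to\infty$; (c) for all $k\ge1$ and $C\in\mathcal{C}_k$, $\inf_{n\ge k}\frac{|\{D\in\mathcal{C}_n: D\subset C\}|}{\kappa(n)}>0$. The action of $G$ (by homeomorphisms) is deeply transitive with respect to $(\mathcal{C}_i)$ if for each $i\ge1$, each $1\le r\le\kappa(i)$, and all pairs of $r$-element subsets $\{A_1,\dots,A_r\},\{B_1,\dots,B_r\}$ of $\mathcal{C}_i$, there is $g\in G$ with $\{g(A_1),\dots,g(A_r)\}=\{B_1,\dots,B_r\}$. $G$ acts deeply transitively on $X$ if there is a tree structure with respect to which the action is deeply transitive. *)

(* Defs.v *)
From HB Require Import structures.
From mathcomp Require Import all_boot all_order all_algebra finmap.
From mathcomp Require Import all_classical all_reals all_analysis.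

Set Implicit Arguments.
Unset Strict Implicit.
Unset Printing Implicit Defensive.
Import Order.TTheory GRing.Theory Num.Theory.
Import numFieldNormedType.Exports.

Local Open Scope classical_set_scope.
Local Open Scope ring_scope.

(* Pointedness is the library's way of saying that the space is nonempty; it is
   also required by [measurableType]. *)
#[short(type="pmetricType")]
HB.structure Definition PointedMetric (K : numDomainType) :=
  {M of Metric K M & isPointed M}.

Section metric_facts.
Context {R : realType} {X : metricType R}.
Implicit Types (x y : X) (A : set X).

Lemma compact_mdist_bounded A x0 : compact A ->
  exists M, forall x, A x -> mdist x0 x <= M.
Proof.
move=> /compact_near_coveringP cA.
have /= := cA R (+oo%R) (fun M x => mdist x0 x <= M) _.
case.
  move=> x Ax.
  exists ([set y | mdist x y < 1], [set M | mdist x0 x + 1 <= M]) => /=.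
    split; last by exists (mdist x0 x + 1); split; [exact: num_real|move=> M /ltW].
    by have := nbhsx_ballx x 1 ltr01; rewrite ballEmdist.
  move=> [y M] /= [xy]; apply: le_trans.
  by rewrite (le_trans (metric_triangle x0 x y))// lerD2l ltW.
by move=> M [_ /(_ (M + 1))]; rewrite ltrDl ltr01 => /(_ isT) h; exists (M + 1).
Qed.

Lemma compact_unif_continuous A (f : X -> X) (e : R) :
    compact A -> continuous f -> 0 < e ->
  exists2 d, 0 < d & forall x y, A x -> mdist x y < d -> mdist (f x) (f y) < e.
Proof.
move=> /compact_near_coveringP cA cf e0.
have e20 : 0 < e / 2 by rewrite divr_gt0.
have := cA R (0^'+)
  (fun d x => forall y, mdist x y < d -> mdist (f x) (f y) < e) _.
case.
  move=> x Ax.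
  have := cf x _ (nbhsx_ballx (f x) _ e20).
  rewrite ballEmdist /= => /nbhs_ballP[d /= d0]; rewrite ballEmdist => fd.
  have d20 : 0 < d / 2 by rewrite divr_gt0.
  exists ([set y | mdist x y < d / 2], [set r | r < d / 2]) => /=.
    split; last exact: nbhs_right_lt.
    by have := nbhsx_ballx x _ d20; rewrite ballEmdist.
  move=> [y r] /= [xy rd] z yz.
  rewrite (splitr e) (le_lt_trans (metric_triangle _ (f x) _))// ltrD//.
    rewrite metric_sym; apply: fd => /=.
    by rewrite (lt_trans xy)// gtr_pMr// invf_lt1// ltr1n.
  apply: fd => /=; rewrite (le_lt_trans (metric_triangle _ y _))//.
  by rewrite (splitr d) ltrD// (lt_trans yz).
move=> d /= d0 h; exists (d / 2); first by rewrite divr_gt0.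
move=> x y Ax xy; apply: (h (d / 2)) => //=.
- rewrite sub0r normrN gtr0_norm ?divr_gt0//.
  by rewrite gtr_pMr// invf_lt1// ltr1n.
- by rewrite divr_gt0.
Qed.

End metric_facts.

Record compacts (R : realType) (X : metricType R) := Compacts {
  cset :> set X ;
  cset_neq0 : cset !=set0 ;
  cset_compact : compact cset }.

Section hausdorff_metric.
Context {R : realType} {X : metricType R}.
Implicit Types (x y : X) (A B C : compacts X).

Lemma compacts_eq A B : A `<=` B -> B `<=` A -> A = B.
Proof.
case: A B => [A A0 cA] [B B0 cB] /= AB BA.
have E : A = B by apply/seteqP.
by case: _ / E in B0 cB *; congr Compacts; exact: Prop_irrelevance.
Qed.

Definition dist_to x (B : set X) : R := inf [set mdist x y | y in B].

Definition excess (A B : set X) : R := sup [set dist_to x B | x in A].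

Definition hausdorff_dist A B : R := Num.max (excess A B) (excess B A).

Lemma dist_to_has_inf x B : has_inf [set mdist x y | y in B].
Proof.
split; first by have [b Bb] := cset_neq0 B; exists (mdist x b), b.
by exists 0 => _ [y _ <-]; exact: mdist_ge0.
Qed.

Lemma dist_to_ge0 x B : 0 <= dist_to x B.
Proof.
apply: lb_le_inf; first by have [] := dist_to_has_inf x B.
by move=> _ [y _ <-]; exact: mdist_ge0.
Qed.

Lemma dist_to_le x y B : cset B y -> dist_to x B <= mdist x y.
Proof.
by move=> By; apply: ge_inf; [have [] := dist_to_has_inf x B|exists y].
Qed.

Lemma dist_to_lt x B e : dist_to x B < e -> exists2 y, cset B y & mdist x y < e.
Proof.
move=> xBe; have e0 : 0 < e - dist_to x B by rewrite subr_gt0.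
have [_ [y By <-]] := inf_adherent e0 (dist_to_has_inf x B).
by rewrite -/(dist_to x B) addrC subrK => xy; exists y.
Qed.

Lemma excess_has_sup A B : has_sup [set dist_to x B | x in A].
Proof.
split; first by have [a Aa] := cset_neq0 A; exists (dist_to a B), a.
have [b Bb] := cset_neq0 B.
have [M AM] := compact_mdist_bounded b (@cset_compact _ _ A).
exists M => _ [x Ax <-]; rewrite (le_trans (dist_to_le x Bb))//.
by rewrite metric_sym AM.
Qed.

Lemma dist_to_excess x A B : cset A x -> dist_to x B <= excess A B.
Proof.
by move=> Ax; apply: sup_upper_bound; [exact: excess_has_sup|exists x].
Qed.

Lemma excess_le A B e :
  (forall x, cset A x -> dist_to x B <= e) -> excess A B <= e.
Proof.
move=> AB; apply: ge_sup; first by have [] := excess_has_sup A B.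
by move=> _ [x /AB + <-].
Qed.

Lemma excessxx A : excess A A = 0.
Proof.
apply/eqP; rewrite eq_le; apply/andP; split.
  by apply: excess_le => x Ax; rewrite -(mdistxx x) dist_to_le.
have [a Aa] := cset_neq0 A.
by rewrite (le_trans (dist_to_ge0 a A))// dist_to_excess.
Qed.

Lemma excess_eq0 A B : excess A B <= 0 -> A `<=` B.
Proof.
move=> AB0 x Ax.
have /closure_id -> : closed B.
  by apply: compact_closed; [exact: metric_hausdorff|exact: cset_compact].
move=> U /nbhs_ballP[e /= e0 xeU].
have /dist_to_lt[y By xy] : dist_to x B < e.
  by rewrite (le_lt_trans (dist_to_excess _ Ax))// (le_lt_trans AB0).
by exists y; split=> //; apply: xeU; rewrite ballEmdist.
Qed.

Lemma excess_triangle B A C : excess A C <= excess A B + excess B C.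
Proof.
apply: excess_le => x Ax; apply/ler_addgt0Pr => e e0.
have /dist_to_lt[y By xy] : dist_to x B < excess A B + e / 2.
  by rewrite (le_lt_trans (dist_to_excess _ Ax))// ltrDl divr_gt0.
have /dist_to_lt[z Cz yz] : dist_to y C < excess B C + e / 2.
  by rewrite (le_lt_trans (dist_to_excess _ By))// ltrDl divr_gt0.
rewrite (le_trans (dist_to_le x Cz))// (le_trans (metric_triangle _ y _))//.
by rewrite [in leRHS](splitr e) addrACA ltW// ltrD.
Qed.

Lemma hausdorff_distxx A : hausdorff_dist A A = 0.
Proof. by rewrite /hausdorff_dist excessxx maxxx. Qed.

Lemma hausdorff_dist_eq0 A B : hausdorff_dist A B = 0 -> A = B.
Proof.
move=> AB0; have : hausdorff_dist A B <= 0 by rewrite AB0.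
rewrite ge_max => /andP[AB BA].
by apply: compacts_eq; exact: excess_eq0.
Qed.

Lemma hausdorff_dist_sym A B : hausdorff_dist A B = hausdorff_dist B A.
Proof. by rewrite /hausdorff_dist maxC. Qed.

Lemma hausdorff_dist_triangle B A C :
  hausdorff_dist A C <= hausdorff_dist A B + hausdorff_dist B C.
Proof.
rewrite {1}/hausdorff_dist ge_max; apply/andP; split.
  by rewrite (le_trans (excess_triangle B A C))// lerD// le_max lexx.
rewrite (le_trans (excess_triangle B C A))// addrC.
by rewrite lerD// le_max lexx orbT.
Qed.

End hausdorff_metric.

HB.instance Definition _ (R : realType) (X : metricType R) :=
  gen_eqMixin (compacts X).
HB.instance Definition _ (R : realType) (X : metricType R) :=
  gen_choiceMixin (compacts X).
HB.instance Definition _ (R : realType) (X : metricType R) :=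
  @isMetric.Build R (compacts X) hausdorff_dist
    hausdorff_distxx hausdorff_dist_eq0 hausdorff_dist_sym
    hausdorff_dist_triangle.
HB.instance Definition _ (R : realType) (X : pmetricType R) :=
  isPointed.Build (compacts X)
    (Compacts (ex_intro [set (point : X)] point erefl) (@compact_set1 X point)).

Definition whole (R : realType) (X : pmetricType R)
    (cX : compact [set: X]) : compacts X :=
  Compacts (ex_intro [set: X] point I) cX.

Lemma cantor_like_compact (T : topologicalType) :
  cantor_like T -> compact [set: T].
Proof. by case. Qed.

Record continuous_action (G : groupType) (Z : topologicalType) :=
  ContinuousAction {
    act :> G -> Z -> Z ;
    act1 : forall z, act 1%g z = z ;
    actM : forall g h z, act (g * h)%g z = act g (act h z) ;
    act_continuous : forall g, continuous (act g) }.

Section compacts_action.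
Context {R : realType} {X : metricType R} {G : groupType}.
Variable a : continuous_action G X.

Definition compacts_act (g : G) (A : compacts X) : compacts X :=
  Compacts (image_nonempty (a g) (cset_neq0 A))
    (continuous_compact (continuous_subspaceT (@act_continuous _ _ a g))
       (@cset_compact _ _ A)).

Lemma compacts_act1 A : compacts_act 1%g A = A.
Proof.
apply: compacts_eq => [_ [x Ax <-]|x Ax]; first by rewrite act1.
by exists x => //; rewrite act1.
Qed.

Lemma compacts_actM g h A :
  compacts_act (g * h)%g A = compacts_act g (compacts_act h A).
Proof.
apply: compacts_eq => [_ [x Ax <-]|_ [_ [x Ax <-] <-]].
  by rewrite actM; exists (a h x) => //; exists x.
by exists x => //; rewrite actM.
Qed.

Lemma compacts_act_continuous g : continuous (compacts_act g).
Proof.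
move=> A U /nbhs_ballP[e /= e0 AeU].
have e20 : 0 < e / 2 by rewrite divr_gt0.
have [d d0 ad] := compact_unif_continuous (@cset_compact _ _ A)
  (@act_continuous _ _ a g) e20.
apply/nbhs_ballP; exists d => //= B; rewrite ballEmdist => /= AB.
apply: AeU; rewrite ballEmdist /=.
have {AB} : hausdorff_dist A B < d by [].
rewrite gt_max => /andP[AB BA].
apply: (@le_lt_trans _ _ (e / 2)); last first.
  by rewrite gtr_pMr// invf_lt1// ltr1n.
change (hausdorff_dist (compacts_act g A) (compacts_act g B) <= e / 2).
rewrite ge_max; apply/andP; split.
  apply: excess_le => _ [x Ax <-].
  have /dist_to_lt[y By xy] := le_lt_trans (dist_to_excess B Ax) AB.
  have gBy : cset (compacts_act g B) (a g y) by exists y.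
  by rewrite (le_trans (dist_to_le _ gBy))// ltW// ad.
apply: excess_le => _ [y By <-].
have /dist_to_lt[x Ax yx] := le_lt_trans (dist_to_excess A By) BA.
have gAx : cset (compacts_act g A) (a g x) by exists x.
by rewrite (le_trans (dist_to_le _ gAx))// metric_sym ltW// ad// metric_sym.
Qed.

Definition compacts_action : continuous_action G (compacts X) :=
  ContinuousAction compacts_act1 compacts_actM compacts_act_continuous.

End compacts_action.

Notation borel Z := (g_sigma_algebraType (@open Z)).

Definition invariant_measures (R : realType) (G : groupType)
    (Z : ptopologicalType) (a : continuous_action G Z) :
    set (probability (borel Z) R) :=
  [set mu | forall (g : G) (A : set (borel Z)), measurable A ->
    mu (a g @^-1` A) = mu A].
Arguments invariant_measures R {G Z} a.

(* Measures are compared on measurable sets only: their values elsewhere are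
   not constrained. *)
Definition uniquely_ergodic_with (R : realType) (G : groupType)
    (Z : ptopologicalType) (a : continuous_action G Z)
    (m : probability (borel Z) R) : Prop :=
  invariant_measures R a m /\
  forall nu, invariant_measures R a nu ->
    forall A : set (borel Z), measurable A -> nu A = m A.

Section product_power.
Context d (T : measurableType d) (R : realType).

Definition pair_cons n (p : T * n.-tuple T) : n.+1.-tuple T :=
  [the n.+1.-tuple T of p.1 :: p.2].

Lemma measurable_pair_cons n :
  measurable_fun [set: T * n.-tuple T] (@pair_cons n).
Proof. exact: measurable_cons. Qed.

HB.instance Definition _ n :=
  isMeasurableFun.Build _ _ _ _ (@pair_cons n) (@measurable_pair_cons n).

Fixpoint product_power (mu : probability T R) (n : nat) :
    probability (n.-tuple T) R :=
  match n with
  | 0 => dirac [tuple]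
  | n'.+1 => distribution (mu \x product_power mu n')%E (@pair_cons n')
  end.

Lemma product_powerE (mu : probability T R) n (A : 'I_n -> set T) :
  (forall i, measurable (A i)) ->
  product_power mu n [set t | forall i, A i (tnth t i)] =
    (\prod_(i < n) mu (A i))%E.
Proof.
elim: n A => [|n IH] A mA.
  rewrite big_ord0 /= diracE mem_set//=.
  by case.
rewrite big_ord_recl -IH//= /distribution /pushforward.
rewrite -product_measure1E//; last first.
  rewrite (_ : [set _ | _] =
      \bigcap_(i in [set: 'I_n]) ((@tnth n T)^~ i @^-1` A (lift ord0 i))).
    apply: fin_bigcap_measurable => // i _.
    by rewrite -[X in measurable X]setTI; exact: measurable_tnth.
  by apply/seteqP; split=> [t h i _|t h i]; apply: h.
congr (_ _); apply/seteqP; split=> [[x t] /= h|[x t] /= [h0 h] i].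
  split=> [|i]; first exact: (h ord0).
  by have := h (lift ord0 i); rewrite tnthS.
case: (unliftP ord0 i) => [j|] ->; last exact: h0.
by rewrite tnthS.
Qed.

End product_power.

Section finite_random_sets.
Context {R : realType} {X : pmetricType R}.

Lemma tuple_set_neq0 k (t : k.+1.-tuple X) : [set x | x \in t] !=set0.
Proof. by exists (thead t); rewrite /= mem_tnth. Qed.

Lemma tuple_set_compact k (t : k.-tuple X) : compact [set x | x \in t].
Proof. exact/finite_compact/finite_seq. Qed.

(* [rho k] is the map (x_1, ..., x_(k+1)) |-> {x_1, ..., x_(k+1)}: the number of
   points is [k.+1], so that the image is nonempty. *)
Definition rho (k : nat) (t : k.+1.-tuple (borel X)) : borel (compacts X) :=
  Compacts (tuple_set_neq0 t) (@tuple_set_compact k.+1 t).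

(* The law of {x_1, ..., x_(k+1)} for iid points x_i of law [mu]. The space of
   tuples carries the product sigma-algebra, which is its Borel sigma-algebra
   when [X] is compact. *)
Definition finite_set_law (mu : probability (borel X) R) (k : nat) :
    set (borel (compacts X)) -> \bar R :=
  pushforward (product_power mu k.+1) (@rho k).

End finite_random_sets.

Section deep_transitivity.
Context {R : realType} {X : metricType R}.

Definition diam (A : set X) : R := sup [set mdist x y | x in A & y in A].

(* Levels are indexed from 0 instead of 1. *)
Record tree_structure (C : nat -> {fset set X}) : Prop := TreeStructure {
  tree_partition : forall i, partition [set` C i] id [set: X] ;
  tree_clopen : forall i A, A \in C i -> clopen A ;
  tree_refine : forall i B, B \in C i.+1 -> exists2 A, A \in C i & B `<=` A ;
  tree_mesh : (\big[Num.max/0]_(A <- C i) diam A) @[i --> \oo] --> (0 : R) ;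
  tree_density : forall k A, A \in C k ->
    0 < inf [set (#|` [fset B in C n | `[< (B `<=` A)%classic >] ]%fset|%:R
                    / #|` C n|%:R : R) | n in [set n | (k <= n)%N]] }.

Definition deeply_transitive_wrt (G : groupType) (a : continuous_action G X)
    (C : nat -> {fset set X}) : Prop :=
  forall (i r : nat), (1 <= r <= #|` C i|)%N ->
  forall A B : {fset set X},
    (A `<=` C i)%fset -> (B `<=` C i)%fset -> #|` A| = r -> #|` B| = r ->
  exists g : G, [fset (a g @` U)%classic | U in A]%fset = B.

Definition deeply_transitive (G : groupType) (a : continuous_action G X) :=
  exists C, tree_structure C /\ deeply_transitive_wrt a C.

End deep_transitivity.

(* Main.v *)
From HB Require Import structures.
Require Import Defs.
From mathcomp Require Import all_boot all_order all_algebra finmap.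
From mathcomp Require Import all_classical all_reals all_analysis.
From mathcomp Require Import measurable_realfun.

Set Implicit Arguments.
Unset Strict Implicit.
Unset Printing Implicit Defensive.
Import Order.TTheory GRing.Theory Num.Theory.
Import numFieldNormedType.Exports.
Local Open Scope classical_set_scope.
Local Open Scope ring_scope.

(** A random compact set A is studied through its traces: the trace of A at
    level n is the set of level-n cells that A meets. Traces at all levels
    determine the law of A, since the events that constrain one trace form an
    algebra of clopen sets generating the Borel sigma-algebra
    ([borel_trace_cylinders]).

    If g maps the cells of S onto the cells of T, then A meets exactly the cells
    of S if and only if gA meets exactly those of T. Deep transitivity thus
    forces, for an invariant law, the probability that the trace is S to depend
    on the cardinality of S only ([trace_exchangeable]): given the number of
    cells met, the trace is uniformly distributed.

    The number of cells met increases with the level, to the cardinality of A.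
    So the hyperspace splits into the classes of the compact sets with exactly k
    points, k >= 1, and the class of the infinite ones, and the law of A is
    identified on each class.

    Infinite sets. A uniform random set of s cells of level m avoids all the
    subcells of a given cell D with probability at most (1 - e)^s, where e > 0
    bounds below the proportion of level-m cells that lie in D. Since s tends to
    infinity with m, an infinite A almost surely meets every cell, and a compact
    set that meets every cell is X ([infinite_whole]).

    Sets with k points. Two exchangeable laws are proportional on the events
    that only concern traces with k cells ([trace_proportional]). This is
    applied to the law nu of A and to the law of a set of k independent points
    drawn from mu. The latter is invariant because mu is
    ([finite_set_probability_invariant]); and all cells of a level having the
    same mu-measure and their number being unbounded, mu has no atom, so that k
    independent points are almost surely distinct ([finite_set_exactly]). As the
    level tends to infinity, proportionality becomes an equality between the
    restriction of nu to the sets with k points and a multiple of this second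
    law ([exactly_law]).

    Absence of invariant measures on X. If nu charges the sets with k points,
    then the mean number of points that A has in B, computed on this class, is a
    nonzero finite invariant measure of B ([exactly_invariant_measure]). Hence
    when X has no invariant probability measure, nu is carried by the infinite
    sets, that is to say by X itself. *)

(** * The cell of a point at a given level *)

Section tree_cells.
Context {R : realType} {X : pmetricType R}.
Variable C : nat -> {fset set X}.
Hypothesis tC : tree_structure C.

Lemma cell_exists n (x : X) : exists D : C n, val D x.
Proof.
have [+ _ _] := tree_partition tC n.
move=> /seteqP[_ /(_ x I)][A /= AC Ax].
by exists [` AC]%fset.
Qed.

Definition cell n (x : X) : C n := sval (cid (cell_exists n x)).

Lemma mem_cell n x : val (cell n x) x.
Proof. exact: (svalP (cid (cell_exists n x))). Qed.

Lemma cell_eq n (D : C n) x : val D x -> cell n x = D.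
Proof.
move=> Dx; apply/val_inj.
have [_ /(_ (val (cell n x)) (val D)) + _] := tree_partition tC n.
apply=> /=; [exact: fsvalP|exact: fsvalP|].
by exists x; split => //; exact: mem_cell.
Qed.

Lemma val_cellP n (D : C n) x : val D x <-> cell n x = D.
Proof. by split=> [/cell_eq//|<-]; exact: mem_cell. Qed.

Lemma cell_nonempty n (D : C n) : exists x, val D x.
Proof.
have [_ _ /(_ (val D))] := tree_partition tC n.
by apply; exact: fsvalP.
Qed.

Lemma cell_sub_next n x : val (cell n.+1 x) `<=` val (cell n x).
Proof.
have [A AC DA] := tree_refine tC (fsvalP (cell n.+1 x)).
suff -> : cell n x = [` AC]%fset by [].
by apply: cell_eq => /=; apply: DA; exact: mem_cell.
Qed.

Lemma cell_sub n m x : (n <= m)%N -> val (cell m x) `<=` val (cell n x).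
Proof.
move=> /subnK <-; elim: (m - n)%N => [//|k IH].
by apply: subset_trans IH; exact: cell_sub_next.
Qed.

Lemma cell_refine n m x y : (n <= m)%N -> cell m x = cell m y ->
  cell n x = cell n y.
Proof.
move=> nm xy; apply/esym/cell_eq; apply: (cell_sub nm).
by rewrite xy; exact: mem_cell.
Qed.

Lemma diam_cell n (x y : X) : compact [set: X] -> cell n x = cell n y ->
  mdist x y <= diam (val (cell n x)).
Proof.
move=> cX xy; apply: sup_upper_bound; last first.
  by exists x; [exact: mem_cell|exists y => //; rewrite xy; exact: mem_cell].
split.
  exists (mdist x x), x; first exact: mem_cell.
  by exists x => //; exact: mem_cell.
have [M hM] := compact_mdist_bounded x cX.
exists (M + M) => _ [u _ [v _ <-]].
rewrite (le_trans (metric_triangle _ x _))// lerD ?hM//.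
by rewrite metric_sym hM.
Qed.

Lemma cells_small (e : R) : compact [set: X] -> 0 < e ->
  exists N, forall n, (N <= n)%N -> forall x y, cell n x = cell n y ->
    mdist x y < e.
Proof.
move=> cX e0.
have /cvgrPdist_lt/(_ e e0)[N _ hN] := tree_mesh tC.
exists N => n Nn x y xy.
rewrite (le_lt_trans (diam_cell cX xy))//.
have := hN n Nn; rewrite /= sub0r normrN; apply: le_lt_trans.
rewrite (le_trans _ (ler_norm _))//.
by apply: le_bigmax_seq => //; exact: fsvalP.
Qed.

(** Finitely many points end up in pairwise distinct cells because the mesh
    tends to 0. The list form serves all the comparisons between the cardinality
    of a set and the number of cells that it meets. *)
Lemma cells_separate (s : seq X) : compact [set: X] ->
  exists N, forall n, (N <= n)%N -> {in s &, injective (cell n)}.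
Proof.
move=> cX.
have sep x y : exists N, forall n, (N <= n)%N -> cell n x = cell n y -> x = y.
  have [->|xy] := eqVneq x y; first by exists 0%N.
  have [|N hN] := cells_small cX (_ : 0 < mdist x y).
    by rewrite mdist_gt0.
  by exists N => n Nn /(hN _ Nn); rewrite ltxx.
pose f p := sval (cid (sep p.1 p.2)).
exists (\max_(p <- [seq (x, y) | x <- s, y <- s]) f p)%N => n hn x y xs ys.
apply: (svalP (cid (sep x y))); apply: leq_trans hn.
rewrite -[X in (X <= _)%N]/(f (x, y)).
by apply: leq_bigmax_seq => //; apply: allpairs_f.
Qed.

(** A Lebesgue number of the partition into cells: by compactness of X, the
    openness of the cells is uniform. *)
Lemma cell_locally_constant n : compact [set: X] ->
  exists2 d : R, 0 < d & forall x y, mdist x y < d -> cell n x = cell n y.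
Proof.
move=> /compact_near_coveringP cX.
have := cX R (0^'+) (fun d x => forall y, mdist x y < d -> cell n x = cell n y) _.
case.
  move=> x _.
  have [oD _] := tree_clopen tC (fsvalP (cell n x)).
  have := open_nbhs_nbhs (conj oD (mem_cell n x)).
  move=> /nbhs_ballP[d /= d0]; rewrite ballEmdist => fd.
  have d20 : 0 < d / 2 by rewrite divr_gt0.
  exists ([set y | mdist x y < d / 2], [set r | r < d / 2]) => /=.
    split; last exact: nbhs_right_lt.
    by have := nbhsx_ballx x _ d20; rewrite ballEmdist.
  move=> [y r] /= [xy rd] z yz.
  have /cell_eq-> : val (cell n x) y.
    apply: fd => /=; rewrite (lt_trans xy)// gtr_pMr// invf_lt1// ltr1n//.
  have /cell_eq-> // : val (cell n x) z.
  apply: fd => /=; rewrite (le_lt_trans (metric_triangle _ y _))//.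
  by rewrite (splitr d) ltrD// (lt_trans yz).
move=> d /= d0 h; exists (d / 2); first by rewrite divr_gt0.
move=> x y xy; apply: (h (d / 2)) => //=.
- rewrite sub0r normrN gtr0_norm ?divr_gt0//.
  by rewrite gtr_pMr// invf_lt1// ltr1n.
- by rewrite divr_gt0.
Qed.

Lemma cell_density n (D : C n) : exists2 e : R, 0 < e & forall m, (n <= m)%N ->
  e * #|{: C m}|%:R <= #|[set E : C m | `[< val E `<=` val D >]]%SET|%:R.
Proof.
have := tree_density tC (fsvalP D).
set S := [set _ | _ in _] => S0.
exists (inf S) => // m nm.
have Cm0 : (0 < #|{: C m}|)%N by apply/card_gt0P; exists (cell m point).
rewrite -ler_pdivlMr ?ltr0n//; apply: ge_inf.
  by exists 0 => _ [k _ <-]; rewrite divr_ge0.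
exists m => //=; rewrite [in X in _ / X]cardfE; congr (_%:R / _).
rewrite cardE -(size_map val).
apply/perm_size/uniq_perm; first exact: fset_uniq.
  by rewrite (map_inj_uniq val_inj) enum_uniq.
move=> B; rewrite !inE /=; apply/idP/mapP => [/andP[BC BD]|[E + ->]].
  exists [` BC]%fset => //; rewrite mem_enum inE. exact: BD.
by rewrite mem_enum inE fsvalP.
Qed.

(** A perfect Hausdorff space has no isolated point, so it is infinite, and its
    points get separated by the cells. *)
Lemma card_cells_unbounded N : cantor_like X ->
  exists n, forall m, (n <= m)%N -> (N <= #|{: C m}|)%N.
Proof.
move=> [[_ /seteqP[_ pX]] cX hX _].
(* If X were finite, the complement of the other points would isolate [point]. *)
have [B _ BN] : exists2 B : {fset X}, [set` B] `<=` [set: X] & (#|` B| >= N)%N.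
  apply/infinite_set_fset => fX.
  have := pX point I.
  move=> /(_ (~` (setT `\ point))) [].
    apply: open_nbhs_nbhs; split; last by move=> [_]; apply.
    apply: closed_openC; apply: (compact_closed hX).
    by apply: finite_compact; apply: sub_finite_set fX.
  by move=> y [/eqP yp _]; apply; split.
have [n hn] := cells_separate (enum_fset B) cX.
exists n => m nm; rewrite (leq_trans BN)//.
rewrite -(size_map (cell m)).
have/card_uniqP <- : uniq (map (cell m) (enum_fset B)).
  by rewrite map_inj_in_uniq ?fset_uniq//; exact: hn.
exact: max_card.
Qed.

End tree_cells.

(** * Borel sigma-algebras generated by finite-valued observations *)

Section cylinders.
Context {Z : topologicalType} {F : nat -> finType} (t : forall n, Z -> F n).

Definition cylinder n (P : {set F n}) : set Z := [set z | t n z \in P].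

Definition cylinders : set (set Z) :=
  [set B | exists n (P : {set F n}), B = cylinder P].

Hypothesis t_open : forall n a, open (t n @^-1` [set a]).
Hypothesis t_coherent : forall n m z z', (n <= m)%N ->
  t m z = t m z' -> t n z = t n z'.
Hypothesis t_base : forall z U, nbhs z U ->
  exists n, forall z', t n z' = t n z -> U z'.

Lemma open_cylinder n (P : {set F n}) : open (cylinder P).
Proof.
rewrite (_ : cylinder P = \bigcup_(a in [set` P]) t n @^-1` [set a]).
  by apply: bigcup_open => a _; exact: t_open.
apply/seteqP; split => [z /= zP|z [a aP /= za]]; first by exists (t n z).
by rewrite /cylinder /= za.
Qed.

Lemma cylindersT : cylinders [set: Z].
Proof.
exists 0%N, [set: F 0%N]%SET; apply/seteqP; split => // z _.
by rewrite /cylinder /= inE.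
Qed.

(** Two observations can be read off from the finer of the two levels. *)
Lemma setI_closed_cylinders : setI_closed cylinders.
Proof.
have lvl n m (P : {set F n}) (Q : {set F m}) : (n <= m)%N ->
    cylinders (cylinder P `&` cylinder Q).
  move=> nm.
  exists m, [set a in Q | `[< exists2 z, t m z = a & t n z \in P >]]%SET.
  apply/seteqP; split => z /=; rewrite /cylinder /= inE.
    by move=> [zP zQ]; rewrite zQ/=; apply/asboolP; exists z.
  move=> /andP[zQ /asboolP[z' z'z z'P]]; split => //.
  by rewrite -(t_coherent nm z'z).
move=> _ _ [n [P ->]] [m [Q ->]].
have [|mn] := leqP n m; first exact: lvl.
by rewrite setIC; apply: lvl; exact: ltnW.
Qed.

(** An open set is the union, over the countably many levels, of the cylinders
    that it contains. *)
Lemma borel_cylinders : <<s @open Z >> = <<s cylinders >>.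
Proof.
apply/seteqP; split; last first.
  apply: smallest_sub; first exact: smallest_sigma_algebra.
  by move=> _ [n [P ->]]; apply: sub_sigma_algebra; exact: open_cylinder.
apply: smallest_sub; first exact: smallest_sigma_algebra.
move=> U oU.
pose inU n := [set a : F n | `[< forall z, t n z = a -> U z >]]%SET.
rewrite (_ : U = \bigcup_n cylinder (inU n)).
  apply: sigma_algebra_bigcup => n; apply: sub_sigma_algebra.
  by exists n, (inU n).
apply/seteqP; split => [z Uz|z [n _]].
  have [n zn] := t_base (open_nbhs_nbhs (conj oU Uz)).
  by exists n => //; rewrite /cylinder /= inE; apply/asboolP.
by rewrite /cylinder /= inE => /asboolP; apply.
Qed.

End cylinders.

Section traces.
Context {R : realType} {X : pmetricType R}.
Variable C : nat -> {fset set X}.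

Definition trace n (A : set X) : {set C n} :=
  [set D : C n | `[< A `&` val D !=set0 >]]%SET.

Definition coarsen n m (T : {set C m}) : {set C n} :=
  [set D : C n | [exists E in T, `[< val E `<=` val D >]]]%SET.

Hypothesis tC : tree_structure C.
Hypothesis cX : compact [set: X].
Local Notation cell := (cell tC).

Lemma in_traceP n A (D : C n) :
  reflect (exists2 x, A x & cell n x = D) (D \in trace n A).
Proof.
rewrite inE; apply: (iffP (asboolP _)) => [[x [Ax /cell_eq xD]]|[x Ax xD]].
  by exists x.
by exists x; split => //; apply/val_cellP.
Qed.

Lemma mem_trace n (A : set X) x : A x -> cell n x \in trace n A.
Proof. by move=> Ax; apply/in_traceP; exists x. Qed.

Lemma trace_gt0 n (A : set X) : A !=set0 -> (0 < #|trace n A|)%N.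
Proof. by move=> [x Ax]; apply/card_gt0P; exists (cell n x); exact: mem_trace. Qed.

(** The trace at a fine level determines the coarser ones; this is the coherence
    that makes the trace events an algebra. *)
Lemma trace_coarsen n m A : (n <= m)%N -> trace n A = coarsen n (trace m A).
Proof.
move=> nm; apply/setP => D; rewrite [RHS]inE; apply/in_traceP/exists_inP.
  move=> [x Ax <-]; exists (cell m x); first exact: mem_trace.
  by apply/asboolP; exact: cell_sub.
move=> [E /in_traceP[x Ax <-] /asboolP ED]; exists x => //.
by apply/val_cellP/ED; exact: mem_cell.
Qed.

Lemma card_trace_homo n m A : (n <= m)%N -> (#|trace n A| <= #|trace m A|)%N.
Proof.
move=> nm; pose f (E : C m) := cell n (sval (cid (cell_nonempty tC E))).
rewrite (leq_trans _ (leq_imset_card f _))//.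
apply: subset_leq_card; apply/fintype.subsetP => D.
move=> /in_traceP[x Ax <-]; apply/imsetP; exists (cell m x); first exact: mem_trace.
rewrite /f; case: cid => y /= yx; apply: (cell_refine nm).
by apply/esym/cell_eq.
Qed.

Lemma trace_full (A : compacts X) :
  (forall n (D : C n), D \in trace n A) -> cset A = [set: X].
Proof.
move=> full; apply/seteqP; split => // x _.
have /closure_id -> : closed A.
  by apply: compact_closed; [exact: metric_hausdorff|exact: cset_compact].
move=> U /nbhs_ballP[e /= e0 xeU].
have [N hN] := cells_small tC cX e0.
have /in_traceP[y Ay yx] := full N (cell N x).
exists y; split => //; apply: xeU; rewrite ballEmdist /=.
by apply: (hN N).
Qed.

Lemma cell_base (x : X) U : nbhs x U ->
  exists n, forall y, cell n y = cell n x -> U y.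
Proof.
move=> /nbhs_ballP[e /= e0 xeU]; have [N hN] := cells_small tC cX e0.
exists N => y yx; apply: xeU; rewrite ballEmdist /=.
by apply: (hN N).
Qed.

Lemma open_cell n (D : C n) : open (cell n @^-1` [set D]).
Proof.
rewrite (_ : _ @^-1` _ = val D); first by case: (tree_clopen tC (fsvalP D)).
by apply/seteqP; split => x /(val_cellP tC).
Qed.

(** Compact sets with the same trace at a level of mesh less than e are at
    Hausdorff distance at most e. *)
Lemma trace_base (A : compacts X) U : nbhs A U ->
  exists n, forall B : compacts X, trace n B = trace n A -> U B.
Proof.
move=> /nbhs_ballP[e /= e0 AeU].
have e20 : 0 < e / 2 by rewrite divr_gt0.
have [N hN] := cells_small tC cX e20.
have exc (B B' : compacts X) : trace N B = trace N B' -> excess B B' <= e / 2.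
  move=> BB'; apply: excess_le => x Bx.
  have /in_traceP[y B'y yx] : cell N x \in trace N B' by rewrite -BB' mem_trace.
  by rewrite (le_trans (dist_to_le x B'y))// ltW//; apply: (hN N).
exists N => B BA; apply: AeU; rewrite ballEmdist.
change (hausdorff_dist A B < e).
apply: (@le_lt_trans _ _ (e / 2)); last by rewrite gtr_pMr// invf_lt1// ltr1n.
by rewrite ge_max !exc.
Qed.

(** Each point of a compact set B close to A shares its cell with a point of A,
    and conversely, as soon as the Hausdorff distance is below a Lebesgue
    number. *)
Lemma open_trace n (S : {set C n}) :
  open ((fun A : compacts X => trace n A) @^-1` [set S]).
Proof.
rewrite openE => A /= AS.
have [d d0 hd] := cell_locally_constant tC n cX.
have sub (B B' : compacts X) : excess B B' < d -> trace n B \subset trace n B'.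
  move=> BB'; apply/fintype.subsetP => D /in_traceP[x Bx <-].
  have /dist_to_lt[y B'y xy] := le_lt_trans (dist_to_excess B' Bx) BB'.
  by rewrite (hd _ _ xy) mem_trace.
apply/nbhs_ballP; exists d => //= B; rewrite ballEmdist => /= AB.
have {AB} : hausdorff_dist A B < d by [].
rewrite gt_max => /andP[AB BA]; rewrite -AS.
by apply/eqP; rewrite finset.eqEsubset !sub.
Qed.

Lemma trace_coherent n m (A B : set X) : (n <= m)%N ->
  trace m A = trace m B -> trace n A = trace n B.
Proof. by move=> nm AB; rewrite !(trace_coarsen _ nm) AB. Qed.

(** The trace as a map on the hyperspace itself, the form in which it is an
    observation generating the Borel sets. *)
Definition ctrace n (A : compacts X) : {set C n} := trace n A.

Lemma borel_cell_cylinders :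
  @measurable _ (borel X) = <<s cylinders (fun n => cell n) >>.
Proof.
apply: borel_cylinders; first exact: open_cell.
exact: cell_base.
Qed.

Lemma borel_trace_cylinders :
  @measurable _ (borel (compacts X)) = <<s cylinders ctrace >>.
Proof.
apply: borel_cylinders; first exact: open_trace.
exact: trace_base.
Qed.

Lemma setI_closed_cell_cylinders : setI_closed (cylinders (fun n => cell n)).
Proof. by apply: setI_closed_cylinders => n m x y; exact: cell_refine. Qed.

Lemma setI_closed_trace_cylinders : setI_closed (cylinders ctrace).
Proof. by apply: setI_closed_cylinders => n m A B; exact: trace_coherent. Qed.

Lemma measurable_cell n (P : {set C n}) :
  measurable ([set x | cell n x \in P] : set (borel X)).
Proof.
apply: sub_sigma_algebra.
exact: (@open_cylinder X (fun n => C n) (fun n => cell n) open_cell).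
Qed.

Lemma measurable_trace n (P : {set {set C n}}) :
  measurable ([set A | trace n (cset A) \in P] : set (borel (compacts X))).
Proof.
apply: sub_sigma_algebra.
exact: (@open_cylinder (compacts X) (fun n => {set C n}) ctrace open_trace).
Qed.

End traces.

(** * Exchangeability of the traces of an invariant random compact *)

Section finite_fibers.
Local Open Scope ereal_scope.
Context d (T : measurableType d) (R : realType) (I : finType).
Variables (mu : {measure set T -> \bar R}) (f : T -> I).
Hypothesis mf : forall i, measurable (f @^-1` [set i]).

Lemma measure_fibers (B : set T) : measurable B ->
  mu B = \sum_i mu (B `&` f @^-1` [set i]).
Proof.
move=> mB; rewrite -[in RHS]big_enum/=.
rewrite fsbig_seq ?enum_uniq// -measure_fin_bigcup//.
- rewrite -setI_bigcupr; congr (mu _); apply/seteqP; split => [x Bx|x []//].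
  by split => //; exists (f x) => //=; rewrite mem_enum.
- by move=> i j _ _ [x [[_ <-] [_ <-]]].
- by move=> i _; apply: measurableI => //; exact: mf.
Qed.

Lemma measurable_fiber (P : {set I}) : measurable [set x | f x \in P].
Proof.
rewrite (_ : [set _ | _] = \bigcup_(i in [set` P]) f @^-1` [set i]).
  apply: fin_bigcup_measurable => [|i _]; last exact: mf.
  exact: finite_finset.
apply/seteqP; split => [x /= fP|x [i iP /= fx]]; last by rewrite /= fx.
by exists (f x).
Qed.

Lemma measure_fiber (P : {set I}) :
  mu [set x | f x \in P] = \sum_(i in P) mu (f @^-1` [set i]).
Proof.
rewrite (measure_fibers (measurable_fiber P)) [RHS]big_mkcond.
apply: eq_bigr => i _; case: ifPn => iP.
  by congr (mu _); apply/seteqP; split => [x []//|x /= fx]; rewrite /preimage/= fx.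
rewrite (_ : _ `&` _ = set0) ?measure0//.
by apply/seteqP; split => // x [/= + fx]; rewrite fx (negPf iP).
Qed.

End finite_fibers.

Section binomials.

(** The probability that s draws without replacement among N cells avoid N - a
    of them is at most what it is for draws with replacement, (a / N)^s: each
    factor (a - i) / (N - i) is at most a / N. *)
Lemma bin_expn_le a N s : (a <= N)%N -> ('C(a, s) * N ^ s <= 'C(N, s) * a ^ s)%N.
Proof.
move=> aN; rewrite -(leq_pmul2r (fact_gt0 s)) mulnAC bin_ffact.
rewrite [in leqRHS]mulnAC bin_ffact.
elim: s => [//|s IH].
rewrite !ffactnSr !expnSr mulnACA [in leqRHS]mulnACA leq_mul//.
by rewrite mulnBl mulnBl mulnC leq_sub2l// leq_mul2l aN orbT.
Qed.

Lemma bin_le_exp {R : realFieldType} (e : R) a N s : (0 < N)%N -> (a <= N)%N ->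
  a%:R <= e * N%:R -> 'C(a, s)%:R <= e ^+ s * 'C(N, s)%:R.
Proof.
move=> N0 aN aeN; have Ns0 : 0 < N%:R ^+ s :> R by rewrite exprn_gt0// ltr0n.
rewrite -(ler_pM2r Ns0) -[_ ^+ _ in leLHS]natrX -natrM.
apply: (@le_trans _ _ ('C(N, s) * a ^ s)%:R).
  by rewrite ler_nat bin_expn_le.
rewrite natrM natrX mulrAC -exprMn mulrC ler_wpM2r//.
by rewrite lerXn2r ?nnegrE//; apply: le_trans aeN.
Qed.

End binomials.

Section exchangeability.
Local Open Scope ereal_scope.
Context {R : realType} {X : pmetricType R} {G : groupType}.
Variables (a : continuous_action G X) (C : nat -> {fset set X}).
Hypothesis tC : tree_structure C.
Hypothesis cX : compact [set: X].
Hypothesis dt : deeply_transitive_wrt a C.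
Local Notation cell := (cell tC).
Local Notation trace := (trace C).

Lemma act_inj g : injective (a g).
Proof.
by move=> x y xy; rewrite -[x](act1 a) -[y](act1 a) -(mulVg g) !actM xy.
Qed.

(** Deep transitivity between sets of indices of cells: it yields g with { g D :
    D in S } = T, as two inclusions. *)
Lemma deeply_transitive_cells n (S T : {set C n}) : #|S| = #|T| ->
  (0 < #|S|)%N ->
  exists g, (forall D, D \in S -> exists2 E, E \in T & a g @` val D = val E) /\
            (forall E, E \in T -> exists2 D, D \in S & a g @` val D = val E).
Proof.
move=> ST S0.
pose fs (U : {set C n}) := [fset val D | D in U]%fset.
have fsP (U : {set C n}) B : reflect (exists2 D, D \in U & B = val D) (B \in fs U).
  by apply: (iffP (imfsetP _ _ _ _)) => /= -[D DU ->]; exists D.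
have fssub U : (fs U `<=` C n)%fset.
  by apply/fsubsetP => _ /fsP[D _ ->]; exact: fsvalP.
have cfs U : #|` fs U| = #|U|.
  by rewrite card_imfset/= -?cardE//; exact: val_inj.
have [] := dt _ (fssub S) (fssub T) (cfs S) _.
- rewrite S0 -cfs; exact: fsubset_leq_card.
- by rewrite cfs.
move=> g /fsetP gST; exists g; split.
  move=> D DS; have : (a g @` val D)%classic \in fs T.
    by rewrite -gST; apply/imfsetP; exists (val D) => //; apply/fsP; exists D.
  by move=> /fsP[E ET DE]; exists E.
move=> E ET; have : val E \in fs T by apply/fsP; exists E.
by rewrite -gST => /imfsetP[_ /= /fsP[D DS ->] ->]; exists D.
Qed.

Lemma traceP n (A : set X) (S : {set C n}) : trace n A = S <->
  (forall x, A x -> cell n x \in S) /\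
  (forall D, D \in S -> exists2 x, A x & val D x).
Proof.
split=> [<-|[AS SA]].
  split=> [x Ax|D /(in_traceP tC)[x Ax <-]]; first exact: mem_trace.
  by exists x => //; exact: mem_cell.
apply/setP => D; apply/(in_traceP tC)/idP => [[x Ax <-]|/SA[x Ax Dx]].
  exact: AS.
by exists x => //; exact: cell_eq.
Qed.

(** Other cells than those of S may be mapped by g to sets that are not cells;
    nevertheless A meets exactly the cells of S precisely when A is contained in
    the union of S and meets each of its members, and g transports these two
    conditions. *)
Lemma trace_act g n (S T : {set C n}) (A : set X) :
  (forall D, D \in S -> exists2 E, E \in T & a g @` val D = val E) ->
  (forall E, E \in T -> exists2 D, D \in S & a g @` val D = val E) ->
  trace n (a g @` A) = T <-> trace n A = S.
Proof.
move=> gST gTS; split=> /traceP [h1 h2]; apply/traceP; split.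
- move=> x Ax; have /gTS[D DS gD] := h1 (a g x) (ex_intro2 _ _ x Ax erefl).
  have := mem_cell tC n (a g x); rewrite -gD => -[y Dy /act_inj yx].
  by rewrite (_ : cell n x = D)//; apply: cell_eq; rewrite -yx.
- move=> D /gST[E ET gD]; have [_ [x Ax <-]] := h2 _ ET.
  by rewrite -gD => -[y Dy /act_inj yx]; exists x => //; rewrite -yx.
- move=> _ [x Ax <-]; have /gST[E ET gE] := h1 _ Ax.
  rewrite (_ : cell n (a g x) = E)//; apply: cell_eq; rewrite -gE.
  by exists x => //; exact: mem_cell.
- move=> E /gTS[D DS gD]; have [x Ax Dx] := h2 _ DS.
  by exists (a g x); [exists x|rewrite -gD; exists x].
Qed.

Variable nu : probability (borel (compacts X)) R.
Hypothesis inv : invariant_measures R (compacts_action a) nu.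

Lemma trace_exchangeable n (S T : {set C n}) : #|S| = #|T| -> (0 < #|S|)%N ->
  nu [set A | trace n (cset A) = S] = nu [set A | trace n (cset A) = T].
Proof.
move=> ST S0; have [g [gST gTS]] := deeply_transitive_cells ST S0.
have mT : measurable ([set A | trace n (cset A) = T] : set (borel (compacts X))).
  have := measurable_trace tC cX [set T]%SET; congr measurable.
  by apply/seteqP; split => A /=; rewrite inE => /eqP.
rewrite -(inv g mT); congr (nu _); apply/seteqP.
by split => A /(trace_act _ gST gTS).
Qed.

Lemma measurable_trace_fiber n (S : {set C n}) :
  measurable ((fun A : borel (compacts X) => trace n (cset A)) @^-1` [set S]).
Proof. by apply: sub_sigma_algebra; exact: open_trace. Qed.

Lemma measure_trace_card n k (P : {set {set C n}}) (S0 : {set C n}) :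
  (forall S, S \in P -> #|S| = k) -> #|S0| = k -> (0 < k)%N ->
  nu [set A | trace n (cset A) \in P] =
  #|P|%:R%:E * nu [set A | trace n (cset A) = S0].
Proof.
move=> Pk S0k k0; rewrite (measure_fiber nu (@measurable_trace_fiber n)).
rewrite (eq_bigr (fun=> nu [set A | trace n (cset A) = S0])); last first.
  by move=> S SP; apply: trace_exchangeable; rewrite Pk.
by rewrite sumr_const mule_natl.
Qed.

(** Given that the trace has k elements, it is a uniform k-subset, and the bound
    is the comparison of binomial coefficients [bin_le_exp]. *)
Lemma trace_avoid_card n k (U : {set C n}) (e : R) : (0 < k)%N ->
  (#|~: U|%:R <= e * #|{: C n}|%:R)%R ->
  nu [set A | (#|trace n (cset A)| == k) && (trace n (cset A) \subset ~: U)] <=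
  (e ^+ k)%:E * nu [set A | #|trace n (cset A)| == k].
Proof.
move=> k0 Ue.
pose P := [set S : {set C n} | S \subset [set: C n]%SET & #|S| == k]%SET.
pose Q := [set S : {set C n} | S \subset ~: U & #|S| == k]%SET.
rewrite (_ : [set A | _ && _] = [set A | trace n (cset A) \in Q]); last first.
  by apply/seteqP; split => A /=; rewrite inE andbC.
rewrite (_ : [set A | _ == k] = [set A | trace n (cset A) \in P]); last first.
  by apply/seteqP; split => A /=; rewrite inE finset.subsetT.
have [P0|[S0]] := set_0Vmem P.
  have QP : Q \subset P.
    by apply/fintype.subsetP => S; rewrite !inE finset.subsetT => /andP[_].
  rewrite (_ : Q = finset.set0) ?P0; last first.
    by apply/eqP; rewrite -finset.subset0 -P0.
  rewrite (_ : [set A | _] = set0) ?measure0 ?mule0//.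
  by apply/seteqP; split => // A /=; rewrite inE.
rewrite inE => /andP[_ /eqP S0k].
rewrite (@measure_trace_card n k Q S0)//; last first.
  by move=> S; rewrite inE => /andP[_ /eqP].
rewrite (@measure_trace_card n k P S0)//; last first.
  by move=> S; rewrite inE => /andP[_ /eqP].
rewrite muleA lee_wpmul2r// -EFinM lee_fin !cards_draws cardsT.
apply: bin_le_exp => //; last exact: max_card.
by apply/card_gt0P; exists (cell n point).
Qed.

End exchangeability.

(** * Number of cells met, and almost sure shape of infinite random compacts *)

Section cardinality.
Local Open Scope ereal_scope.
Context {R : realType} {X : pmetricType R} {G : groupType}.
Variables (a : continuous_action G X) (C : nat -> {fset set X}).
Hypothesis tC : tree_structure C.
Hypothesis cX : compact [set: X].
Local Notation trace := (trace C).

Lemma measurable_trace_pred n (p : pred {set C n}) :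
  measurable ([set A | p (trace n (cset A))] : set (borel (compacts X))).
Proof.
have := measurable_trace tC cX [set S | p S]%SET; congr measurable.
by apply/seteqP; split => A /=; rewrite inE.
Qed.

(** The compact sets with at most k points ([at_mostP]), described by traces so
    that measurability is immediate. Accordingly [seqD at_most k.+1] is the
    class of the sets with exactly k.+1 points. *)
Definition at_most k : set (borel (compacts X)) :=
  [set A | forall n, (#|trace n (cset A)| <= k)%N].

Lemma at_mostE k : at_most k =
  \bigcap_n [set A | (#|trace n (cset A)| <= k)%N].
Proof. by apply/seteqP; split => A h n => [_|]; exact: h. Qed.

Lemma measurable_at_most k : measurable (at_most k).
Proof.
rewrite at_mostE; apply: bigcapT_measurable => n.
exact: (measurable_trace_pred (fun S => #|S| <= k)%N).
Qed.

Lemma at_most_nondecreasing : nondecreasing_seq at_most.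
Proof.
by move=> k l kl; apply/subsetPset => A Ak n; exact: leq_trans (Ak n) kl.
Qed.

Lemma at_most0 : at_most 0 = set0.
Proof.
apply/seteqP; split => // A /(_ 0%N).
by rewrite leqNgt (trace_gt0 tC)//; exact: cset_neq0.
Qed.

Lemma measurable_exactly k : measurable (seqD at_most k).
Proof.
case: k => [|k]; first exact: measurable_at_most.
by apply: measurableD; exact: measurable_at_most.
Qed.

(** The number of cells met increases to the cardinality, so each of the events
    where it is at most l decreases to [at_most l]; an event of equality is a
    difference of two of these. *)
Lemma measure_card_trace_cvg (nu : probability (borel (compacts X)) R) k
    (B : set (borel (compacts X))) : measurable B ->
  nu (B `&` [set A | #|trace n (cset A)| == k.+1]) @[n --> \oo]
    --> nu (B `&` seqD at_most k.+1).
Proof.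
move=> mB.
pose le l n : set (borel (compacts X)) := [set A | (#|trace n (cset A)| <= l)%N].
have mle l n : measurable (le l n).
  exact: (measurable_trace_pred (fun S => #|S| <= l)%N).
have cvgle l : nu (B `&` le l n) @[n --> \oo] --> nu (B `&` at_most l).
  rewrite (_ : B `&` at_most l = \bigcap_n (B `&` le l n)); last first.
    by rewrite at_mostE bigcapIr//; exists 0%N.
  apply: (@nonincreasing_cvg_mu _ _ _ nu (fun n => B `&` le l n)).
  - by rewrite (le_lt_trans (probability_le1 _ _)) ?ltry//; exact: measurableI.
  - by move=> n; exact: measurableI.
  - by apply: bigcapT_measurable => n; exact: measurableI.
  - move=> n m nm; apply/subsetPset => A [BA Am]; split => //.
    exact: leq_trans (card_trace_homo tC A nm) Am.
have diff (S T : set (borel (compacts X))) : measurable S -> measurable T ->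
    T `<=` S -> nu (B `&` (S `\` T)) = nu (B `&` S) - nu (B `&` T).
  move=> mS mT TS; rewrite setIDA measureD//.
  - by rewrite -setIA (setIidr TS).
  - exact: measurableI.
  - by rewrite (le_lt_trans (probability_le1 _ _)) ?ltry//; exact: measurableI.
rewrite (_ : (fun n => _) =
    (fun n => nu (B `&` le k.+1 n) - nu (B `&` le k n))); last first.
  apply/funext => n; rewrite -diff//; last by move=> A; exact: leqW.
  congr (nu (_ `&` _)); apply/seteqP; split => A /=; rewrite /le /=.
    by move=> /eqP ->; rewrite ltnn.
  by move=> [Ak /negP]; rewrite -ltnNge => kA; rewrite eqn_leq Ak kA.
rewrite diff; [|exact: measurable_at_most|exact: measurable_at_most|].
  apply: cvgeB; [|exact: cvgle|exact: cvgle].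
  apply: fin_num_adde_defr; rewrite ge0_fin_numE//.
  rewrite (le_lt_trans (probability_le1 _ _)) ?ltry//; apply: measurableI => //.
  exact: measurable_at_most.
by apply/subsetPset/at_most_nondecreasing.
Qed.

Hypothesis dt : deeply_transitive_wrt a C.

(** Both laws are uniform on the traces with k elements, so each side is the
    product of the cardinality of P, the number of k-subsets of the set of
    cells, and the two probabilities of a single trace. *)
Lemma trace_proportional (nu lam : probability (borel (compacts X)) R) n k
    (P : {set {set C n}}) :
  invariant_measures R (compacts_action a) nu ->
  invariant_measures R (compacts_action a) lam ->
  (0 < k)%N -> (forall S, S \in P -> #|S| = k) ->
  nu [set A | trace n (cset A) \in P] * lam [set A | #|trace n (cset A)| == k] =
  lam [set A | trace n (cset A) \in P] * nu [set A | #|trace n (cset A)| == k].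
Proof.
move=> inu ilam k0 Pk.
have [->|[S0 S0P]] := set_0Vmem P.
  rewrite (_ : [set A | _ \in finset.set0] = set0) ?measure0 ?mul0e//.
  by apply/seteqP; split => // A /=; rewrite inE.
pose Q := [set S : {set C n} | #|S| == k]%SET.
have Qk S : S \in Q -> #|S| = k by rewrite inE => /eqP.
rewrite (_ : [set A | _ == k] = [set A | trace n (cset A) \in Q]); last first.
  by apply/seteqP; split => A /=; rewrite inE.
have S0k := Pk _ S0P.
rewrite !(measure_trace_card tC cX dt inu _ S0k)//.
rewrite !(measure_trace_card tC cX dt ilam _ S0k)//.
by rewrite muleACA [in RHS]muleACA; congr (_ * _); rewrite muleC.
Qed.

(** Sum of [trace_avoid_card] over the possible cardinalities k >= r of the
    trace. *)
Lemma trace_avoid (nu : probability (borel (compacts X)) R) n r (U : {set C n})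
    (e : R) :
  invariant_measures R (compacts_action a) nu -> (0 < r)%N ->
  (0 <= e <= 1)%R -> (#|~: U|%:R <= e * #|{: C n}|%:R)%R ->
  nu [set A | (r <= #|trace n (cset A)|)%N && (trace n (cset A) \subset ~: U)] <=
  (e ^+ r)%:E.
Proof.
move=> inu r0 /andP[e0 e1] Ue.
pose f (A : borel (compacts X)) : 'I_(#|{: C n}|).+1 := inord #|trace n (cset A)|.
have fE i : f @^-1` [set i] = [set A | #|trace n (cset A)| == i].
  apply/seteqP; split => A /=; rewrite /f.
    by move=> <-; rewrite inordK// ltnS max_card.
  by move=> /eqP Ai; apply/val_inj; rewrite /= inordK// ltnS max_card.
have mf i : measurable (f @^-1` [set i]).
  rewrite fE; exact: (measurable_trace_pred (fun S => #|S| == i)).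
pose B : set (borel (compacts X)) :=
  [set A | (r <= #|trace n (cset A)|)%N && (trace n (cset A) \subset ~: U)].
rewrite -[X in nu X]/B.
have mB : measurable B.
  exact: (measurable_trace_pred (fun S => (r <= #|S|)%N && (S \subset ~: U))).
rewrite (measure_fibers nu mf mB) -[leRHS]mule1 -(probability_setT nu).
rewrite (measure_fibers nu mf measurableT) ge0_sume_distrr//.
apply: lee_sum => i _; rewrite setTI fE.
have [ri|ir] := leqP r i; last first.
  rewrite (_ : B `&` _ = set0) ?measure0 ?mule_ge0 ?lee_fin ?exprn_ge0//.
  apply/seteqP; split => // A [/= /andP[rA _] /eqP Ai].
  by move: ir; rewrite -Ai ltnNge rA.
apply: (@le_trans _ _ ((e ^+ i)%:E * nu [set A | #|trace n (cset A)| == i])).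
  rewrite (le_trans _ (trace_avoid_card tC cX dt inu (leq_trans r0 ri) Ue))//.
  rewrite le_measure ?inE//.
  - apply: measurableI => //.
    exact: (measurable_trace_pred (fun S => #|S| == i)).
  - exact: (measurable_trace_pred (fun S => (#|S| == i) && (S \subset ~: U))).
  - by move=> A [/andP[_ AU] /= ->].
by rewrite lee_wpmul2r// lee_fin ler_wiXn2l.
Qed.

Definition infinitely_many := ~` (\bigcup_k at_most k).

Lemma measurable_infinitely_many : measurable infinitely_many.
Proof.
apply: measurableC; apply: bigcupT_measurable => k.
exact: measurable_at_most.
Qed.

(** For an infinite set the trace at level m has at least r elements for m
    large; it avoids the subcells of D with probability at most (1 - e)^r, for
    every r. *)
Lemma infinite_meets_cell (nu : probability (borel (compacts X)) R) n (D : C n) :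
  invariant_measures R (compacts_action a) nu ->
  nu (infinitely_many `&` [set A | D \notin trace n (cset A)]) = 0.
Proof.
move=> inu; set B := _ `&` _.
have mB : measurable B.
  apply: measurableI; first exact: measurable_infinitely_many.
  exact: (measurable_trace_pred (fun S => D \notin S)).
have [e e0 he] := cell_density tC D.
pose sub m := [set E : C m | `[< val E `<=` val D >]]%SET.
have subC m : (#|~: sub m|%:R = #|{: C m}|%:R - #|sub m|%:R :> R)%R.
  by rewrite -(cardsC (sub m)) natrD addrC addKr.
have N0 m : (0 < #|{: C m}|%:R :> R)%R.
  by rewrite ltr0n; apply/card_gt0P; exists (cell tC m point).
have qN m : (n <= m)%N -> (#|~: sub m|%:R <= (1 - e) * #|{: C m}|%:R)%R.
  by move=> nm; rewrite subC mulrBl mul1r lerB// he.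
have q01 : (0 <= 1 - e <= 1)%R.
  rewrite gerBl (ltW e0) andbT -(pmulr_lge0 _ (N0 n)).
  by rewrite (le_trans _ (qN n _)).
have le_q r : nu B <= ((1 - e) ^+ r.+1)%:E.
  (* Levels start at n, from which on the density bound holds. *)
  pose F m := B `&` [set A | (r.+1 <= #|trace (n + m) (cset A)|)%N].
  have mF m : measurable (F m).
    apply: measurableI => //.
    exact: (measurable_trace_pred (fun S => r < #|S|)%N).
  have BF : B = \bigcup_m F m.
    apply/seteqP; split => [A BA|A [m _ []//]].
    have /existsNP[m /negP] : ~ at_most r A.
      by move=> Ar; case: BA => [+ _]; apply; exists r.
    rewrite -ltnNge => rA.
    exists m => //; split => //=; apply: leq_trans rA _.
    by apply: (card_trace_homo tC); rewrite leq_addl.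
  have ndF : nondecreasing_seq F.
    move=> m m' mm'; apply/subsetPset => A [BA rA]; split => //=.
    by apply: leq_trans rA _; apply: (card_trace_homo tC); rewrite leq_add2l.
  have cvgF : nu (F m) @[m --> \oo] --> nu B.
    by rewrite BF; apply: nondecreasing_cvg_mu => //; rewrite -BF.
  have <- := cvg_lim _ cvgF => //.
  apply: lime_le; first by apply/cvg_ex; exists (nu B).
  apply: nearW => m.
  apply: le_trans (@trace_avoid nu (n + m) r.+1 (sub (n + m)%N) _ inu _ q01 _) => //.
    apply: le_measure; rewrite ?inE//.
      exact: (measurable_trace_pred
        (fun S => (r < #|S|)%N && (S \subset ~: sub (n + m)%N))).
    move=> A [[_ DA] rA] /=; rewrite rA/=; apply/fintype.subsetP => E.
    move=> /(in_traceP tC)[x Ax xE]; rewrite !inE; apply/negP => /asboolP ED.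
    move: DA => /= /negP; apply; apply/(in_traceP tC); exists x => //.
    by apply/(val_cellP tC)/ED; rewrite -xE; exact: mem_cell.
  by apply: qN; rewrite leq_addr.
have e1 : (1 - e < 1)%R by rewrite gtrBl.
have cvgq : (((1 - e) ^+ r)%:E @[r --> \oo] --> (0%R)%:E)%classic.
  apply: cvg_EFin; first by apply: nearW.
  apply: cvg_expr; rewrite ger0_norm//; by case/andP: q01.
apply/eqP; rewrite eq_le measure_ge0 andbT.
apply: (cvge_ge _ cvgq); apply: nearW => r.
rewrite (le_trans (le_q r))// lee_fin ler_wiXn2l//; by case/andP: q01.
Qed.

(** An infinite random compact almost surely meets all of the countably many
    cells, hence is X. *)
Lemma infinite_whole (nu : probability (borel (compacts X)) R)
    (B : set (borel (compacts X))) :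
  invariant_measures R (compacts_action a) nu -> measurable B ->
  nu (B `&` infinitely_many) =
  nu infinitely_many * dirac (whole cX : borel (compacts X)) B.
Proof.
move=> inu mB.
(* The cells of a level are enumerated by their code to get a countable union. *)
pose miss n k := if (choice.unpickle k : option (C n)) is Some D then
    infinitely_many `&` [set A | D \notin trace n (cset A)]
  else set0.
have miss0 n k : nu.-negligible (miss n k).
  rewrite /miss; case: choice.unpickle => [D|]; last exact: negligible_set0.
  apply/negligibleP; last exact: infinite_meets_cell.
  apply: measurableI; first exact: measurable_infinitely_many.
  exact: (measurable_trace_pred (fun S => D \notin S)).
have N0 : nu.-negligible (infinitely_many `\ (whole cX : borel (compacts X))).
  apply: (@negligibleS _ _ _ nu (\bigcup_n \bigcup_k miss n k)); last first.
    by apply: negligible_bigcup => n; exact: negligible_bigcup.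
  move=> A [Ainf AX]; apply: contrapT => NA; apply: AX.
  have AT : cset A = [set: X].
    apply: (trace_full tC cX) => n D; apply: contrapT => /negP DA.
    apply: NA; exists n => //; exists (choice.pickle D) => //.
    by rewrite /miss choice.pickleK; split.
  by apply: compacts_eq => x _ //=; rewrite AT.
have minf := measurable_infinitely_many.
rewrite diracE; have [/set_mem BX|/negP BX] := boolP (_ \in B).
  rewrite mule1 [in RHS](measureDI nu minf mB) [X in X + _]measure_negligible.
  - by rewrite add0e setIC.
  - exact: measurableD.
  - by apply: negligibleS N0 => A [Ai BA]; split => // AX; apply: BA; rewrite AX.
rewrite mule0 measure_negligible//; first exact: measurableI.
apply: negligibleS N0 => A [BA Ai]; split => // AX.
by apply: BX; rewrite -AX; exact: mem_set.
Qed.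

End cardinality.

(** * The law of finitely many independent points *)

Section product_power_invariance.
Local Open Scope ereal_scope.
Context d (T : measurableType d) (R : realType).
Variables (mu : probability T R) (h : T -> T).
Hypothesis mh : measurable_fun [set: T] h.
Hypothesis mu_h : forall A, measurable A -> mu (h @^-1` A) = mu A.

Lemma measurable_map_tuple n :
  measurable_fun [set: n.-tuple T] (fun t => map_tuple h t).
Proof.
apply/measurable_fun_tnthP => i.
rewrite (_ : _ \o _ = h \o (@tnth n T)^~ i).
  by apply: measurableT_comp => //; exact: measurable_tnth.
by apply/funext => t /=; rewrite tnth_map.
Qed.

(** Independent points that are moved by a measure-preserving map remain
    independent with the same law; by induction on their number, with Fubini. *)
Lemma product_power_map n (A : set (n.-tuple T)) : measurable A ->
  product_power mu n ((fun t => map_tuple h t) @^-1` A) = product_power mu n A.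
Proof.
elim: n A => [|n IH] A mA.
  congr (product_power mu 0 _); apply/seteqP.
  by split => t /=; rewrite (tuple0 t) (tuple0 (map_tuple _ _)).
have mmA := @measurable_map_tuple n.+1 measurableT _ mA.
rewrite setTI in mmA.
have mB := @measurable_pair_cons _ T n measurableT _ mA; rewrite setTI in mB.
pose B := @pair_cons _ T n @^-1` A.
pose phi x := product_power mu n (xsection B x).
have mphi : measurable_fun [set: T] (phi : T -> \bar R).
  exact: measurable_fun_xsection.
(* The induction hypothesis moves the tail of the tuple inside each section; the
   invariance of [mu] then moves the head. *)
transitivity (\int[mu]_x (phi \o h) x).
  apply: eq_integral => x _ /=.
  rewrite /phi -IH; last exact: measurable_xsection.
  congr (product_power mu n _); apply/seteqP; split => t /=.
    move=> /xsectionP H; apply/xsectionP.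
    by move: H; rewrite /B /pair_cons /preimage /=; congr A; exact: val_inj.
  move=> /xsectionP H; apply/xsectionP.
  by move: H; rewrite /B /pair_cons /preimage /=; congr A; exact: val_inj.
transitivity (\int[mu]_x phi x); last by [].
rewrite -[LHS](@ge0_integral_pushforward _ _ _ _ _ h mh mu setT phi)//.
by apply: eq_measure_integral => /= U mU _; exact: mu_h.
Qed.

End product_power_invariance.

Section finite_random_compacts.
Local Open Scope ereal_scope.
Context {R : realType} {X : pmetricType R} {G : groupType}.
Variables (a : continuous_action G X) (C : nat -> {fset set X}).
Hypothesis tC : tree_structure C.
Hypothesis cX : compact [set: X].
Local Notation cell := (cell tC).
Local Notation trace := (trace C).

Definition cell_tuple n k (t : k.-tuple (borel X)) : k.-tuple (C n) :=
  map_tuple (cell n) t.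

Lemma measurable_cell_tuple n k (s : k.-tuple (C n)) :
  measurable (@cell_tuple n k @^-1` [set s]).
Proof.
rewrite (_ : _ @^-1` _ = \bigcap_(i in [set: 'I_k])
    ((@tnth k (borel X))^~ i @^-1` [set x | cell n x \in [set tnth s i]%SET])).
  apply: fin_bigcap_measurable => // i _.
  rewrite -[X in measurable X]setTI; apply: measurable_tnth => //.
  exact: measurable_cell.
apply/seteqP; split => t /=.
  by move=> <- i _ /=; rewrite inE tnth_map.
move=> ts; apply: eq_from_tnth => i.
by have := ts i I; rewrite /= inE tnth_map => /eqP.
Qed.

Lemma trace_rho n k (t : k.+1.-tuple (borel X)) :
  trace n (cset (rho t)) = [set D in cell_tuple n t]%SET.
Proof.
apply/setP => D; rewrite [RHS]inE.
apply/(in_traceP tC)/mapP => [[x xt <-]|[x xt ->]].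
  by exists x.
by exists x.
Qed.

Lemma measurable_rho k : measurable_fun [set: k.+1.-tuple (borel X)] (@rho R X k).
Proof.
apply: (@measurability _ _ _ (borel (compacts X)) [set: _] (@rho R X k)
  (cylinders (@ctrace R X C)) (borel_trace_cylinders tC cX)).
move=> _ [_ [n [P ->]] <-]; rewrite setTI.
have := measurable_fiber (@measurable_cell_tuple n k.+1)
  [set s : k.+1.-tuple (C n) | [set D in s]%SET \in P]%SET.
congr measurable; apply/seteqP; split => t /=.
  by rewrite inE -trace_rho.
by rewrite /preimage /cylinder /ctrace /= trace_rho inE.
Qed.

HB.instance Definition _ k :=
  isMeasurableFun.Build _ _ _ _ (@rho R X k) (@measurable_rho k).

(** The law [finite_set_law] with its structure of probability measure. *)
Definition finite_set_probability (mu : probability (borel X) R) k :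
  probability (borel (compacts X)) R :=
  distribution (product_power mu k.+1) (@rho R X k).

Lemma finite_set_probabilityE mu k :
  finite_set_probability mu k = finite_set_law mu k :> (set _ -> \bar R).
Proof. by []. Qed.

Lemma measurable_act g : measurable_fun [set: borel X] (a g : borel X -> borel X).
Proof.
apply: (@measurability _ _ _ (borel X) [set: _] (a g : borel X -> borel X)
  (@open X) erefl).
move=> _ [U oU <-]; rewrite setTI; apply: sub_sigma_algebra.
by apply: open_comp => // x _; exact: act_continuous.
Qed.

Lemma finite_set_probability_invariant (mu : probability (borel X) R) k :
  invariant_measures R a mu ->
  invariant_measures R (compacts_action a) (finite_set_probability mu k).
Proof.
move=> imu g A mA.
change (product_power mu k.+1 (@rho R X k @^-1` (compacts_act a g @^-1` A)) =
  product_power mu k.+1 (@rho R X k @^-1` A)).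
have mrA := @measurable_rho k measurableT _ mA; rewrite setTI in mrA.
rewrite -(product_power_map (measurable_act g) (imu g) mrA).
congr (product_power mu k.+1 _); apply/seteqP.
have rho_map (t : k.+1.-tuple (borel X)) :
    rho (map_tuple (a g : borel X -> borel X) t) = compacts_act a g (rho t).
  apply: compacts_eq => x /=; first by move=> /mapP[y yt ->]; exists y.
  by move=> [y /= yt <-]; exact: map_f.
by split => t /=; rewrite /preimage /= -rho_map.
Qed.

(** The action is transitive on the cells of a level, so they all have the same
    measure. *)
Lemma measure_cell (mu : probability (borel X) R) n (D : C n) :
  deeply_transitive_wrt a C -> invariant_measures R a mu ->
  mu [set x | cell n x = D] = (#|{: C n}|%:R^-1)%:E.
Proof.
move=> dt imu.
have mD (E : C n) : measurable ([set x | cell n x = E] : set (borel X)).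
  by apply: sub_sigma_algebra; exact: open_cell.
have same (E : C n) : mu [set x | cell n x = E] = mu [set x | cell n x = D].
  have [||g [gE _]] :=
    deeply_transitive_cells dt (S := [set E]%SET) (T := [set D]%SET).
  - by rewrite !cards1.
  - by rewrite cards1.
  have [D' /set1P -> gED] := gE E (set11 E).
  rewrite -(imu g _ (mD D)); congr (mu _); apply/seteqP; split => x /= /val_cellP xE.
    by apply/val_cellP; rewrite -gED; exists x.
  by apply/val_cellP; move: xE; rewrite -gED => -[y Ey /act_inj <-].
have := probability_setT mu.
rewrite (measure_fibers mu mD measurableT).
rewrite (eq_bigr (fun=> mu [set x | cell n x = D])); last first.
  by move=> E _; rewrite setTI -[RHS](same E).
rewrite sumr_const; set v := mu _ => N1.
have {}N1 : #|{: C n}|%:R%:E * v = 1 by rewrite mule_natl.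
have N0 : (#|{: C n}|%:R != 0 :> R)%R.
  by rewrite pnatr_eq0 -lt0n; apply/card_gt0P; exists D.
transitivity ((#|{: C n}|%:R^-1 * #|{: C n}|%:R)%:E * v).
  by rewrite mulVf// mul1e.
by rewrite EFinM -muleA N1 mule1.
Qed.

Lemma measurable_tnth_cell n k (l : 'I_k) (D : C n) :
  measurable ((fun t : k.-tuple (borel X) => cell n (tnth t l)) @^-1` [set D]).
Proof.
have mD : measurable ([set x | cell n x = D] : set (borel X)).
  by apply: sub_sigma_algebra; exact: open_cell.
by have := @measurable_tnth _ (borel X) k l measurableT _ mD; rewrite setTI.
Qed.

Lemma measurable_same_cell n k (i j : 'I_k) :
  measurable [set t : k.-tuple (borel X) | cell n (tnth t i) = cell n (tnth t j)].
Proof.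
rewrite (_ : [set _ | _] = \bigcup_(D in [set` [set: C n]%SET])
  ((fun t => cell n (tnth t i)) @^-1` [set D] `&`
   (fun t => cell n (tnth t j)) @^-1` [set D])).
  apply: fin_bigcup_measurable => [|D _]; first exact: finite_finset.
  by apply: measurableI; exact: measurable_tnth_cell.
apply/seteqP; split => [t /= tij|t [D _ [/= -> ->]]//].
by exists (cell n (tnth t i)) => //=; rewrite inE.
Qed.

Lemma measure_same_cell (mu : probability (borel X) R) n k (i j : 'I_k) :
  deeply_transitive_wrt a C -> invariant_measures R a mu -> i != j ->
  product_power mu k [set t | cell n (tnth t i) = cell n (tnth t j)] =
  (#|{: C n}|%:R^-1)%:E.
Proof.
move=> dt imu ij.
rewrite (measure_fibers _ (@measurable_tnth_cell n k i)
  (measurable_same_cell n i j)).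
rewrite (eq_bigr (fun=> ((#|{: C n}|%:R^-1) ^+ 2)%:E)); last first.
  move=> D _.
  pose A (l : 'I_k) : set (borel X) :=
    if (l == i) || (l == j) then [set x | cell n x = D] else setT.
  have mA l : measurable (A l).
    rewrite /A; case: ifP => // _.
    by apply: sub_sigma_algebra; exact: open_cell.
  rewrite (_ : _ `&` _ = [set t | forall l, A l (tnth t l)]); last first.
    apply/seteqP; split => [t [/= tij ti] l|t /= h].
      by rewrite /A; case: ifP => //= /orP[/eqP->|/eqP->]; rewrite -?tij.
    have := h i; have := h j; rewrite /A !eqxx orbT /= => tj ti.
    by split; rewrite //= ti tj.
  rewrite [LHS](product_powerE mu mA) (bigD1 i)//= (bigD1 j)/= 1?eq_sym//.
  rewrite big1 => [|l /andP[li lj]]; last first.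
    by rewrite /A (negPf li) (negPf lj) probability_setT.
  have [-> ->] : A i = [set x | cell n x = D] /\ A j = [set x | cell n x = D].
    by rewrite /A !eqxx orbT.
  by rewrite mule1 measure_cell// expr2 EFinM.
rewrite sumr_const; set v := (X in (X *+ _)%R = _).
rewrite (_ : (v *+ _)%R = #|{: C n}|%:R%:E * v); last by rewrite mule_natl.
rewrite /v -EFinM expr2 mulrA divff ?mul1r//.
by rewrite pnatr_eq0 -lt0n; apply/card_gt0P; exists (cell n point).
Qed.

(** Two independent points share their level-n cell with probability the inverse
    of the number of cells, which tends to 0. *)
Lemma diagonal_negligible (mu : probability (borel X) R) k (i j : 'I_k) :
  cantor_like X ->
  deeply_transitive_wrt a C -> invariant_measures R a mu -> i != j ->
  (product_power mu k).-negligible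
    [set t : k.-tuple (borel X) | tnth t i = tnth t j].
Proof.
move=> hX dt imu ij.
pose B n := [set t : k.-tuple (borel X) | cell n (tnth t i) = cell n (tnth t j)].
exists (\bigcap_n B n); split; last by move=> t /= tij n _; rewrite /B /= tij.
  by apply: bigcapT_measurable => n; exact: measurable_same_cell.
apply/eqP; rewrite eq_le measure_ge0 andbT; apply/lee_addgt0Pr => e e0.
have [n hn] := card_cells_unbounded tC (Num.bound e^-1) hX.
have N0 : (0 < #|{: C n}|)%N by apply/card_gt0P; exists (cell n point).
rewrite add0e (@le_trans _ _ (product_power mu k (B n)))//.
  apply: le_measure; rewrite ?inE.
  - by apply: bigcapT_measurable => m; exact: measurable_same_cell.
  - exact: measurable_same_cell.
  - exact: bigcap_inf.
rewrite measure_same_cell// lee_fin invf_ple ?posrE ?ltr0n//.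
rewrite ltW// (lt_le_trans (archi_boundP _)) ?invr_ge0 ?(ltW e0)// ler_nat.
exact: hn.
Qed.

(** The k.+1 independent points form a set with fewer points only if two of them
    coincide. *)
Lemma finite_set_exactly (mu : probability (borel X) R) k
    (B : set (borel (compacts X))) :
  cantor_like X ->
  deeply_transitive_wrt a C -> invariant_measures R a mu -> measurable B ->
  finite_set_law mu k (B `&` seqD (at_most C) k.+1) = finite_set_law mu k B.
Proof.
move=> hX dt imu mB; rewrite -finite_set_probabilityE.
have mE := measurable_exactly tC cX k.+1.
rewrite [RHS](measureDI _ mB mE) [X in X + _]measure_negligible ?add0e//.
  exact: measurableD.
have mBE := measurableD mB mE.
apply/negligibleP => //.
have mr := @measurable_rho k measurableT _ mBE; rewrite setTI in mr.
change (product_power mu k.+1 (@rho R X k @^-1` (B `\` seqD (at_most C) k.+1)) = 0).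
apply: measure_negligible => //.
pose Q p q := if (inord p : 'I_k.+1) != inord q then
  [set t : k.+1.-tuple (borel X) | tnth t (inord p) = tnth t (inord q)] else set0.
apply: (@negligibleS _ _ _ _ (\bigcup_p \bigcup_q Q p q)); last first.
  apply: negligible_bigcup => p; apply: negligible_bigcup => q; rewrite /Q.
  by case: ifPn => pq; [exact: diagonal_negligible|exact: negligible_set0].
move=> t [_ tE]; apply: contrapT => tQ; apply: tE.
have ut : uniq t.
  apply/tuple_uniqP => i j tij; apply: contrapT => /eqP ij; apply: tQ.
  by exists i => //; exists j => //; rewrite /Q !inord_val ij.
split.
  move=> n; rewrite trace_rho cardsE (leq_trans (card_size _))//.
  by rewrite size_tuple.
move=> tk; have [n hn] := cells_separate tC t cX.
have := tk n; rewrite trace_rho cardsE.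
have /card_uniqP -> : uniq (cell_tuple n t).
  by rewrite /= map_inj_in_uniq//; exact: hn.
by rewrite size_tuple ltnn.
Qed.

End finite_random_compacts.

(** * Decomposition of an invariant law by cardinality *)

Section decomposition.
Local Open Scope ereal_scope.
Context {R : realType} {X : pmetricType R} {G : groupType}.
Variables (a : continuous_action G X) (C : nat -> {fset set X}).
Hypothesis tC : tree_structure C.
Hypothesis hX : cantor_like X.
Hypothesis dt : deeply_transitive_wrt a C.
Let cX := cantor_like_compact hX.
Local Notation trace := (trace C).
Variable nu : probability (borel (compacts X)) R.
Hypothesis inu : invariant_measures R (compacts_action a) nu.

Lemma measure_fin_numT (B : set (borel (compacts X))) :
  measurable B -> nu B \is a fin_num.
Proof.
by move=> mB; rewrite ge0_fin_numE// (le_lt_trans (probability_le1 _ _))// ltry.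
Qed.

(** By uniqueness of measures it suffices to compare both sides on the events
    that a level-n trace lies in P. For m >= n, [trace_proportional] at level m
    relates the probabilities of this event joint with the trace at level m
    having k.+1 elements, and m tends to infinity. *)
Lemma exactly_law (mu : probability (borel X) R) k
    (B : set (borel (compacts X))) :
  invariant_measures R a mu -> measurable B ->
  nu (B `&` seqD (at_most C) k.+1) =
  nu (seqD (at_most C) k.+1) * finite_set_law mu k B.
Proof.
move=> imu.
have mE := measurable_exactly tC cX k.+1.
pose lam := finite_set_probability tC cX mu k.
have ilam : invariant_measures R (compacts_action a) lam.
  exact: finite_set_probability_invariant.
have c0 : (0 <= fine (nu (seqD (at_most C) k.+1)))%R by exact: fine_ge0.
have cE : (NngNum c0)%:num%:E = nu (seqD (at_most C) k.+1).
  by rewrite /= fineK// measure_fin_numT.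
rewrite -cE => mB.
have cover : \bigcup_(_ in [set: nat]) [set: borel (compacts X)] = setT.
  by rewrite bigcup_const//; exists 0%N.
have U := @measure_unique _ R (borel (compacts X)) (cylinders (@ctrace R X C))
  (fun=> setT) (borel_trace_cylinders tC cX) (setI_closed_trace_cylinders tC)
  (fun=> cylindersT _) cover
  (mrestr nu mE) (mscale (NngNum c0) lam).
apply: U => //.
- move=> _ [n [P ->]]; set D := cylinder (@ctrace R X C) P.
  have mD : measurable (D : set (borel (compacts X))) by exact: measurable_trace.
  change (nu (D `&` seqD (at_most C) k.+1) =
    (fine (nu (seqD (at_most C) k.+1)))%:E * lam D).
  rewrite fineK; last exact: measure_fin_numT.
  have lamE (F : set (borel (compacts X))) : measurable F ->
      lam (F `&` seqD (at_most C) k.+1) = lam F.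
    by move=> mF; exact: (finite_set_exactly tC cX k hX dt imu mF).
  have lim1 := @measure_card_trace_cvg R X C tC cX nu k _ mD.
  have lim2 := @measure_card_trace_cvg R X C tC cX lam k _ mD.
  have lim3 := @measure_card_trace_cvg R X C tC cX nu k _ measurableT.
  have lim4 := @measure_card_trace_cvg R X C tC cX lam k _ measurableT.
  rewrite lamE// in lim2; rewrite lamE// probability_setT in lim4.
  rewrite setTI in lim3.
  rewrite -[LHS]mule1 [RHS]muleC.
  have finl F : measurable F -> lam F \is a fin_num.
    move=> mF.
    by rewrite ge0_fin_numE// (le_lt_trans (probability_le1 _ _))// ltry.
  have mDE := measurableI _ _ mD mE.
  have lim14 := cvgeM (mule_def_fin (measure_fin_numT mDE) (isT : 1 \is a fin_num))
    lim1 lim4.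
  have lim23 := cvgeM (mule_def_fin (finl _ mD) (measure_fin_numT mE)) lim2 lim3.
  rewrite -(cvg_lim (@ereal_hausdorff R) (lim14 _)).
  apply: cvg_lim => //; apply: cvg_trans (lim23 _).
  apply: near_eq_cvg; near=> m.
  have nm : (n <= m)%N by near: m; exists n.
  (* The event D, joint with the condition on the cardinality, as an event on the
     trace at level m. *)
  pose Q := [set S : {set C m} | (#|S| == k.+1) & (coarsen n S \in P)]%SET.
  have DQ : D `&` [set A | #|trace m (cset A)| == k.+1] =
      [set A | trace m (cset A) \in Q].
    apply/seteqP; split => A /=; rewrite inE /D /cylinder /ctrace /=.
      by move=> [AP ->]; rewrite -trace_coarsen.
    by rewrite -trace_coarsen// => /andP[-> ->].
  rewrite !setTI DQ; apply/esym; apply: (trace_proportional tC cX dt) => //.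
  by move=> S; rewrite inE => /andP[/eqP].
- move=> _; change (nu (setT `&` seqD (at_most C) k.+1) < +oo).
  by rewrite setTI -ge0_fin_numE// measure_fin_numT.
Unshelve. all: by end_near. Qed.

(** The infinite sets have index 0, in accordance with the indexing of the
    coefficients by which X itself has index 0. *)
Definition size_class k : set (borel (compacts X)) :=
  if k is 0%N then infinitely_many C else seqD (at_most C) k.

Lemma measurable_size_class k : measurable (size_class k).
Proof.
case: k => [|k]; first exact: measurable_infinitely_many.
exact: (measurable_exactly _ _ k.+1).
Qed.

Lemma trivIset_size_class : trivIset setT size_class.
Proof.
have tI := trivIset_seqD (@at_most_nondecreasing R X C).
have disj k A : size_class 0 A -> ~ size_class k.+1 A.
  by move=> Ainf [Ak _]; apply: Ainf; exists k.+1.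
move=> [|i] [|j] _ _ //= [A [Ai Aj]].
- by case: (disj j A).
- by case: (disj i A).
- by apply: tI => //; exists A.
Qed.

Lemma bigcup_size_class : \bigcup_k size_class k = setT.
Proof.
apply/seteqP; split => // A _.
have [Ainf|] := pselect (infinitely_many C A); first by exists 0%N.
move=> /contrapT; rewrite -eq_bigcup_seqD => -[[|k] _ Ak]; last by exists k.+1.
by move: Ak; rewrite /seqD (at_most0 tC).
Qed.

Lemma measure_size_class (B : set (borel (compacts X))) : measurable B ->
  nu B = \sum_(0 <= i <oo) nu (B `&` size_class i).
Proof.
move=> mB; rewrite -[in LHS](setIT B) -bigcup_size_class setI_bigcupr.
rewrite measure_bigcup//.
- by apply: eq_eseriesl => i; rewrite in_setT.
- by move=> i _; apply: measurableI => //; exact: measurable_size_class.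
- by apply: trivIset_setIl; exact: trivIset_size_class.
Qed.

End decomposition.

(** * The mean number of points of a random finite set *)

Section counting_facts.
Local Open Scope ereal_scope.
Context {T : choiceType} {R : realType}.
Implicit Types A : set T.

(** A characterization of cardinality that treats finite and infinite sets
    alike. *)
Lemma counting_leP A k : counting A <= k%:R%:E :> \bar R <->
  (forall s : seq T, uniq s -> (forall x, x \in s -> A x) -> (size s <= k)%N).
Proof.
rewrite /counting; split => [|sk].
  case: asboolP => // fA; rewrite lee_fin ler_nat => Ak s us sA.
  rewrite (leq_trans _ Ak)//; apply: uniq_leq_size => // x /sA Ax.
  by rewrite in_fset_set// mem_set.
case: asboolP => [fA|iA].
  rewrite lee_fin ler_nat; apply: sk; first exact: fset_uniq.
  by move=> x; rewrite in_fset_set// => /set_mem.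
have [B BA kB] := infinite_set_fset k.+1 iA.
have := sk (enum_fset B) (fset_uniq B) (fun x xB => BA x xB).
by move=> /(leq_trans kB); rewrite ltnn.
Qed.

Lemma counting_image (f : T -> T) A : injective f ->
  counting (f @` A) = counting A :> \bar R.
Proof.
move=> fI; rewrite /counting.
have fin : finite_set (f @` A) <-> finite_set A.
  by rewrite (eq_finite_set (inj_card_eq (in2W fI))).
case: asboolP => [/fin fA|/fin nA]; last by rewrite asboolF.
by rewrite asboolT// fset_set_image// card_imfset.
Qed.

Lemma counting_uniq A (s : seq T) : uniq s -> (forall x, A x <-> x \in s) ->
  counting A = (size s)%:R%:E :> \bar R.
Proof.
move=> us As; have -> : A = [set` s] by apply/seteqP; split => x /As.
rewrite /counting asboolT//; congr (_%:R%:E).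
apply/perm_size/uniq_perm => //.
by move=> x; rewrite in_fset_set//; apply/idP/idP => [/set_mem|/mem_set].
Qed.

End counting_facts.

Section intensity.
Local Open Scope ereal_scope.
Context {R : realType} {X : pmetricType R} {G : groupType}.
Variables (a : continuous_action G X) (C : nat -> {fset set X}).
Hypothesis tC : tree_structure C.
Hypothesis cX : compact [set: X].
Local Notation cell := (cell tC).
Local Notation trace := (trace C).

Definition count_in (B : set (borel X)) (A : borel (compacts X)) : \bar R :=
  counting ((cset A : set (borel X)) `&` B).

Lemma at_mostP k A : at_most C k A <-> count_in setT A <= k%:R%:E.
Proof.
rewrite /count_in setIT; split => [Ak|/counting_leP Ak n].
  apply/counting_leP => s us sA.
  have [n hn] := cells_separate tC s cX.
  have {}hn := hn n (leqnn n); apply: leq_trans (Ak n).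
  rewrite -(size_map (cell n)).
  have /card_uniqP <- : uniq (map (cell n) s) by rewrite map_inj_in_uniq.
  apply: subset_leq_card; apply/fintype.subsetP => _ /mapP[x xs ->].
  by apply: mem_trace; exact: sA.
(* Distinct cells met by A contain distinct points of A. *)
pose rep (D : C n) : X := xget point (cset A `&` val D).
have repP D : D \in trace n (cset A) -> cset A (rep D) /\ cell n (rep D) = D.
  move=> /(in_traceP tC)[x Ax /(val_cellP tC) xD].
  have [Ar /cell_eq rD] := @xgetPex _ point (cset A `&` val D)
    (ex_intro _ x (conj Ax xD)).
  by split; [exact: Ar|exact: rD].
have := Ak [seq rep D | D <- enum (trace n (cset A))].
rewrite size_map -cardE; apply.
  rewrite map_inj_in_uniq ?enum_uniq// => D E; rewrite !mem_enum.
  by move=> /repP[_ {2}<-] /repP[_ {2}<-] ->.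
by move=> x /mapP[D]; rewrite mem_enum => /repP[Ar _] ->.
Qed.

Lemma at_most_act g k (A : compacts X) :
  at_most C k (compacts_act a g A) <-> at_most C k A.
Proof.
rewrite !at_mostP /count_in !setIT /=.
by rewrite (@counting_image (borel X) R (a g) (cset A))//; exact: act_inj.
Qed.

Lemma exactly_act g k (A : compacts X) :
  seqD (at_most C) k (compacts_act a g A) <-> seqD (at_most C) k A.
Proof.
case: k => [|k]; first exact: at_most_act.
by rewrite /seqD /=; split=> -[/at_most_act Ak1 Ak]; split => //;
  apply: contra_not Ak => /at_most_act.
Qed.

Lemma count_in_exactly k A : seqD (at_most C) k.+1 A ->
  count_in setT A = k.+1%:R%:E.
Proof.
move=> [/at_mostP Ak1 /at_mostP Ak]; apply/eqP; rewrite eq_le Ak1/=.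
move: Ak1 Ak; rewrite /count_in /counting; case: asboolP => // _ _ /negP.
by rewrite -ltNge lte_fin lee_fin ltr_nat ler_nat.
Qed.

(** For a union of level-n cells, the points of a finite set A that it contains
    are counted by the cells met by A, once the level is fine enough to be
    beyond n and to separate the points of A. *)
Lemma count_in_cell_cvg k n (P : {set C n}) A : at_most C k A ->
  (#|[set E in trace m (cset A) |
      `[< val E `<=` [set x | cell n x \in P] >]]%SET|%:R%:E : \bar R) @[m --> \oo]
    --> count_in [set x | cell n x \in P] A.
Proof.
move=> /at_mostP; rewrite /count_in setIT; rewrite {1}/counting.
case: asboolP => // fA _; pose s := enum_fset (fset_set (cset A)).
have sA x : cset A x <-> x \in s.
  by rewrite /s in_fset_set//; split => [/mem_set|/set_mem].
have us : uniq s by exact: fset_uniq.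
pose t := [seq x <- s | cell n x \in P].
have [N hN] := cells_separate tC s cX.
apply: cvg_near_cst; near=> m.
have nm : (n <= m)%N by near: m; exists n.
have Nm : (N <= m)%N by near: m; exists N.
rewrite (@counting_uniq (borel X) R _ t).
- congr (_%:R%:E); rewrite -(size_map (cell m) t).
  have /card_uniqP <- : uniq (map (cell m) t).
    rewrite map_inj_in_uniq ?filter_uniq// => x y.
    rewrite !mem_filter => /andP[_ xs] /andP[_ ys].
    exact: (hN m Nm).
  apply: eq_card => E; rewrite !inE; apply/andP/mapP.
    move=> [/asboolP[x [Ax /cell_eq xE]] /asboolP EP]; exists x; last by rewrite xE.
    rewrite mem_filter (EP x) ?andTb; first by apply/sA.
    by rewrite -xE; exact: mem_cell.
  move=> [x]; rewrite mem_filter => /andP[xP /sA Ax] ->; split; apply/asboolP.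
    by exists x; split => //; exact: mem_cell.
  move=> y /(val_cellP tC) yx /=; rewrite (_ : cell n y = cell n x)//.
  exact: cell_refine nm yx.
- exact: filter_uniq.
- by move=> x; rewrite mem_filter; split => [[/sA -> /= ->]//|/andP[xP /sA Ax]].
Unshelve. all: by end_near. Qed.

Lemma closed_compacts (A : compacts X) : closed (cset A).
Proof. by apply: compact_closed; [exact: metric_hausdorff|exact: cset_compact]. Qed.

Lemma measurable_compacts (A : compacts X) : measurable (cset A : set (borel X)).
Proof.
rewrite -(setCK (cset A)); apply: measurableC; apply: sub_sigma_algebra.
exact/closed_openC/closed_compacts.
Qed.

Lemma count_in_ge0 B A : 0 <= count_in B A.
Proof. exact: measure_ge0. Qed.

Lemma count_inC k B A : measurable B -> seqD (at_most C) k.+1 A ->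
  count_in (~` B) A = k.+1%:R%:E - count_in B A.
Proof.
move=> mB AD; have Ak := count_in_exactly AD.
pose cA : set (borel X) := cset A.
have cAk : [the measure (borel X) R of counting] cA = k.+1%:R%:E.
  by rewrite -Ak /count_in setIT.
have fA : [the measure (borel X) R of counting] cA < +oo by rewrite cAk ltry.
rewrite /count_in -setDE -cAk.
exact: (measureD (measurable_compacts A) mB fA).
Qed.

Lemma count_in_bigcup (F : (set (borel X))^nat) A :
  (forall n, measurable (F n)) -> trivIset setT F ->
  count_in (\bigcup_n F n) A = \sum_(n <oo) count_in (F n) A.
Proof.
move=> mF tF; rewrite /count_in setI_bigcupr.
rewrite (@measure_bigcup _ R (borel X) counting)//.
- by apply: eq_eseriesl => n; rewrite in_setT.
- by move=> n _; apply: measurableI => //; exact: measurable_compacts.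
- exact: trivIset_setIl.
Qed.

(** Finite unions of cells form a pi-system generating the Borel sets, and
    [count_in_cell_cvg] settles them; the Dynkin argument applies because the
    total number of points is constant on the class considered, which gives
    complements. *)
Lemma measurable_count_in k (B : set (borel X)) : measurable B ->
  measurable_fun (seqD (at_most C) k.+1) (count_in B).
Proof.
move=> mB0; have := mB0; rewrite [X in X B](borel_cell_cylinders tC cX).
move: B {mB0}.
have mfT n (P : {set C n}) :
    measurable_fun (seqD (at_most C) k.+1) (count_in [set x | cell n x \in P]).
  pose q m (A : borel (compacts X)) : \bar R := #|[set E in trace m (cset A) |
      `[< val E `<=` [set x | cell n x \in P] >]]%SET|%:R%:E.
  apply: (@emeasurable_fun_cvg _ _ _ _ q).
    move=> m _ Y mY; apply: measurableI; first exact: measurable_exactly.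
    have := measurable_trace_pred tC cX (n := m) (fun S => `[< Y (#|[set E in S |
      `[< val E `<=` [set x | cell n x \in P] >]]%SET|%:R%:E) >]).
    by congr measurable; apply/seteqP; split => A /asboolP.
  move=> A [Ak _]; exact: count_in_cell_cvg Ak.
apply: dynkin_induction.
- exact: borel_cell_cylinders.
- exact: setI_closed_cell_cylinders.
- have := mfT 0%N [set: C 0%N]%SET; congr measurable_fun; congr count_in.
  by apply/seteqP; split => // x _ /=; rewrite inE.
- by move=> _ [n [P ->]]; exact: mfT.
- move=> S mS mfS.
  apply: (@eq_measurable_fun _ _ _ _ _ (fun A => k.+1%:R%:E - count_in S A)).
    by move=> A /set_mem AD; rewrite (count_inC mS AD).
  by apply: emeasurable_funB => //; exact: measurable_cst.
- move=> F mF tF mfF.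
  rewrite (_ : count_in _ = fun A => \sum_(i <oo | i \in predT) count_in (F i) A).
    by apply: ge0_emeasurable_sum => // i A _ _; exact: count_in_ge0.
  by apply/funext => A; exact: count_in_bigcup.
Qed.

Variable nu : probability (borel (compacts X)) R.

(** The intensity measure of the random set restricted to the class of the sets
    with exactly k.+1 points. *)
Definition intensity k (B : set (borel X)) : \bar R :=
  \int[nu]_(A in seqD (at_most C) k.+1) count_in B A.

Section intensity_measure.
Variable k : nat.

Let intensity0 : intensity k set0 = 0.
Proof.
rewrite /intensity (eq_integral (cst 0)) ?integral0// => A _.
by rewrite /count_in setI0 measure0.
Qed.

Let intensity_ge0 B : 0 <= intensity k B.
Proof. by apply: integral_ge0 => A _; exact: count_in_ge0. Qed.

Let intensity_sigma_additive : semi_sigma_additive (intensity k).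
Proof.
move=> F mF tF mUF; rewrite [X in _ --> X](_ : _ =
  \int[nu]_(A in seqD (at_most C) k.+1) \sum_(n <oo) count_in (F n) A); last first.
  by apply: eq_integral => A _; exact: count_in_bigcup.
apply/cvg_closeP; split.
  by apply: is_cvg_nneseries => n _ _; exact: intensity_ge0.
rewrite closeE// integral_nneseries//.
- exact: measurable_exactly.
- by move=> n; exact: measurable_count_in.
Qed.

HB.instance Definition _ := isMeasure.Build _ _ _ (intensity k)
  intensity0 intensity_ge0 intensity_sigma_additive.

End intensity_measure.

Lemma intensityT k : intensity k setT = k.+1%:R%:E * nu (seqD (at_most C) k.+1).
Proof.
rewrite /intensity (eq_integral (cst k.+1%:R%:E)).
  by rewrite integral_cst//; exact: measurable_exactly.
by move=> A /set_mem; exact: count_in_exactly.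
Qed.

Hypothesis inu : invariant_measures R (compacts_action a) nu.

Lemma intensity_invariant k g (B : set (borel X)) : measurable B ->
  intensity k (a g @^-1` B) = intensity k B.
Proof.
move=> mB; pose ag : borel (compacts X) -> borel (compacts X) := compacts_act a g.
have mag : measurable_fun setT ag.
  apply: (@measurability _ _ _ (borel (compacts X)) [set: _] ag
    (@open (compacts X)) erefl).
  move=> _ [U oU <-]; rewrite setTI; apply: sub_sigma_algebra.
  by apply: open_comp => // x _; exact: (act_continuous (c := compacts_action a)).
have mD := measurable_exactly tC cX k.+1.
transitivity (\int[nu]_(A in ag @^-1` seqD (at_most C) k.+1) (count_in B \o ag) A).
  rewrite (_ : ag @^-1` _ = seqD (at_most C) k.+1); last first.
    by apply/seteqP; split => A /(exactly_act g k.+1 A).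
  apply: eq_integral => A _; rewrite /count_in /=.
  rewrite -[LHS](@counting_image (borel X) R (a g)); last exact: act_inj.
  congr counting; apply/seteqP; split => [_ [x [Ax Bx] <-]|_ [[x Ax <-] Bx]].
    by split => //; exists x.
  by exists x.
rewrite -(@ge0_integral_pushforward _ _ _ _ _ ag mag nu _ (count_in B))//.
- by apply: eq_measure_integral => A mA _; exact: inu.
- exact: measurable_count_in.
Qed.

(** The intensity measure is invariant and has total mass k.+1 times the
    probability of the class, which is neither 0 nor infinite; it is then
    normalized. *)
Lemma exactly_invariant_measure k : nu (seqD (at_most C) k.+1) != 0 ->
  exists mu : probability (borel X) R, invariant_measures R a mu.
Proof.
move=> D0; exists (mnormalize (intensity k) (dirac (point : borel X))).
have T0 : intensity k setT != 0.
  by rewrite intensityT mule_eq0 (negPf D0) orbF eqe pnatr_eq0.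
have Too : intensity k setT != +oo.
  rewrite intensityT lt_eqF// lte_mul_pinfty ?lee_fin//.
  rewrite (le_lt_trans (probability_le1 _ _)) ?ltry//.
  exact: measurable_exactly.
have mE (U : set (borel X)) :
    @mnormalize _ _ R (intensity k) (dirac (point : borel X)) U =
    intensity k U * ((fine (intensity k setT))^-1)%:E.
  rewrite /mnormalize; case: ifPn => // /orP[]e; first by move/negP: T0.
  by move/negP: Too.
move=> g B mB; apply: etrans (mE _) (etrans _ (esym (mE _))).
by rewrite intensity_invariant.
Qed.

End intensity.

(** * The classification of invariant random compacts *)

Lemma nneseries_shift {R : realType} (f : (\bar R)^nat) :
  (forall i, 0 <= f i)%E ->
  (\sum_(0 <= i <oo) f i = f 0%N + \sum_(0 <= i <oo) f i.+1)%E.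
Proof.
move=> f0; rewrite nneseries_recl// -nneseries_addn//; congr (_ + _)%E.
by apply: eq_eseriesr => i _; rewrite addn1.
Qed.

Lemma dirac_whole_invariant (R : realType) (X : pmetricType R)
    (cX : compact [set: X]) (G : groupType) (a : continuous_action G X) :
  invariant_measures R (compacts_action a)
    (dirac (whole cX : borel (compacts X))).
Proof.
move=> g A mA; rewrite /= !diracE; congr (_%:R%:E).
have gX : compacts_act a g (whole cX) = whole cX.
  apply: compacts_eq => // x _; exists (a g^-1%g x) => //.
  by rewrite -actM mulgV act1.
rewrite (_ : (_ \in _) = ((whole cX : borel (compacts X)) \in A))//.
by apply/idP/idP => /set_mem; rewrite /preimage/= ?gX => AX; apply/mem_set;
  rewrite /preimage/= ?gX.
Qed.

Theorem theorem7p8 (R : realType) (X : pmetricType R) (hX : cantor_like X)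
    (G : groupType) (hG : countable [set: G]) (a : continuous_action G X)
    (ha : deeply_transitive a) :
  let deltaX : probability (borel (compacts X)) R :=
    dirac (whole (cantor_like_compact hX) : borel (compacts X)) in
  (invariant_measures R a = set0 ->
     uniquely_ergodic_with (compacts_action a) deltaX) /\
  (invariant_measures R a !=set0 ->
   forall mu : probability (borel X) R, invariant_measures R a mu ->
   forall nu : probability (borel (compacts X)) R,
     invariant_measures R (compacts_action a) nu ->
   exists c : nat -> R,
     [/\ forall i, 0 <= c i,
         (\sum_(0 <= i <oo) (c i)%:E = 1)%E
       & forall A : set (borel (compacts X)), measurable A ->
         (nu A = \sum_(0 <= i <oo) (c i.+1)%:E * finite_set_law mu i A
                 + (c 0)%:E * deltaX A)%E]).
Proof.
move=> deltaX; have [C [tC dt]] := ha; have cX := cantor_like_compact hX.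
split=> [noinv|_ mu imu nu inu].
  split; first exact: dirac_whole_invariant.
  move=> nu inu A mA.
  have nu0 k : nu (seqD (at_most C) k.+1) = 0%E.
    apply: contrapT => /eqP /(exactly_invariant_measure tC cX inu)[m im].
    by have : invariant_measures R a m by []; rewrite noinv.
  have nuinf (B : set (borel (compacts X))) : measurable B ->
      nu B = nu (B `&` infinitely_many C).
    move=> mB; rewrite (measure_size_class tC hX nu mB) nneseries_shift//.
    rewrite [X in (_ + X)%E]eseries0 ?adde0// => k _ _.
    have mE := measurable_exactly tC cX k.+1.
    exact: (subset_measure0 (measurableI _ _ mB mE) mE (@subIsetr _ _ _) (nu0 k)).
  have := nuinf _ measurableT; rewrite setTI probability_setT => nu1.
  rewrite nuinf// (infinite_whole tC (cantor_like_compact hX) dt inu mA).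
  by rewrite -nu1 mul1e.
have mS := measurable_size_class tC hX.
have finS i : nu (size_class C i) \is a fin_num.
  exact: (measure_fin_numT nu (mS i)).
exists (fun i => fine (nu (size_class C i))); split.
- by move=> i; exact: fine_ge0.
- rewrite (eq_eseriesr (fun i _ => fineK (finS i))).
  rewrite -(probability_setT nu) (measure_size_class tC hX nu measurableT).
  by apply: eq_eseriesr => i _; rewrite setTI.
- move=> A mA; rewrite (measure_size_class tC hX nu mA) nneseries_shift// addeC.
  congr (_ + _)%E; last first.
    rewrite fineK//.
    exact: (infinite_whole tC (cantor_like_compact hX) dt inu mA).
  apply: eq_eseriesr => i _; rewrite fineK//.
  exact: (exactly_law tC hX dt inu i imu mA).
Qed.
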